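(* Let $(X,\phi)$ be a non-compact, connected calibrated manifold and suppose $X$ is $\phi$-convex. Then $\mathrm{Core}(X)$ is compact if and only if $X$ is strictly $\phi$-convex at $\infty$, and $\mathrm{Core}(X)=\emptyset$ if and only if $X$ is strictly $\phi$-convex.
   Context: A calibrated manifold $(X,\phi)$ of degree $p\ge 1$ is a smooth riemannian manifold $X$ together with a closed smooth $p$-form $\phi$ such that $\phi(\xi)\le 1$ for every unit simple tangent $p$-vector $\xi$ on $X$. $G_x(\phi)$ denotes the set of unit simple $p$-vectors $\xi$ at $x$ with $\phi(\xi)=1$ ($\phi$-planes), and $G(\phi)=\bigcup_xG_x(\phi)$. For $f\in C^\infty(X)$, the $\phi$-Hessian of $f$ is the $p$-form $\mathcal H^\phi(f)(v_1,\dots,v_p)=\sum_{i=1}^p\phi(v_1,\dots,\nabla_{v_i}(\nabla f),\dots,v_p)$ ($\nabla_{v_i}(\nabla f)$ in the $i$-th slot, $\nabla$ the Levi-Civita connection). $f$ is $\phi$-plurisubharmonic if $\mathcal H^\phi(f)(\xi)\ge 0$ for all $\xi\in G(\phi)$, and strictly $\phi$-plurisubharmonic at $x$ if $\mathcal H^\phi(f)(\xi)>0$ for all $\xi\in G_x(\phi)$. $\mathcal{PSH}(X,\phi)$ is the set of all smooth $\phi$-plurisubharmonic functions on $X$. A proper exhaustion function is a function $f:X\to\mathbb R$ such that $\{f\le c\}$ is compact for every $c\in\mathbb R$. $X$ is: $\phi$-convex if it admits a $\phi$-plurisubharmonic proper exhaustion function; strictly $\phi$-convex if it admits a proper exhaustion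 function which is strictly $\phi$-plurisubharmonic at every point; strictly $\phi$-convex at $\infty$ if it admits a $\phi$-plurisubharmonic proper exhaustion function which is strictly $\phi$-plurisubharmonic at every point outside some compact subset. For $f\in\mathcal{PSH}(X,\phi)$ let $W(f)$ be the closed set of points at which $f$ is not strictly $\phi$-plurisubharmonic. The core of $X$ is $\mathrm{Core}(X)=\bigcap_{f\in\mathcal{PSH}(X,\phi)}W(f)$. *)

(* Defs.v *)
From HB Require Import structures.
From mathcomp Require Import all_boot all_order all_algebra.
From mathcomp Require Import all_classical all_reals all_analysis.

Set Implicit Arguments.
Unset Strict Implicit.
Unset Printing Implicit Defensive.

Import Order.TTheory GRing.Theory Num.Theory.
Import numFieldNormedType.Exports.

Local Open Scope classical_set_scope.
Local Open Scope ring_scope.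

(* Tangent vectors are written in charts as row vectors, so a linear map acts *)
(* by multiplication on the right, as in the library's Jacobian 'J.  A p-tuple *)
(* of tangent vectors is the matrix 'M[R]_(p, n) whose rows are the vectors.  *)

Section Calculus.
Variables (R : realType) (n : nat).

Definition e_ (i : 'I_n) : 'rV[R]_n := delta_mx 0 i.

Definition iter_partial (W : normedModType R) (f : 'rV[R]_n -> W)
    (s : seq 'I_n) : 'rV[R]_n -> W :=
  foldr (fun i h y => 'D_(e_ i) h y) f s.

(* C^oo on an open set V: the partial derivatives of all orders exist and are *)
(* differentiable (hence continuous) on V.                                    *)
Definition smooth_on (W : normedModType R) (V : set 'rV[R]_n)
    (f : 'rV[R]_n -> W) : Prop :=
  forall (s : seq 'I_n) (y : 'rV[R]_n), V y ->
    differentiable (iter_partial f s) y.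

Definition set_row (p : nat) (v : 'M[R]_(p, n)) (i : 'I_p) (w : 'rV[R]_n) :
    'M[R]_(p, n) :=
  \matrix_(k, j) (if k == i then w 0 j else v k j).

Definition is_alternating (p : nat) (w : 'M[R]_(p, n) -> R) : Prop :=
  (forall (v : 'M[R]_(p, n)) (i : 'I_p) (a : R) (u u' : 'rV[R]_n),
     w (set_row v i (a *: u + u')) = a * w (set_row v i u) + w (set_row v i u'))
  /\ (forall (v : 'M[R]_(p, n)) (i j : 'I_p),
     i != j -> row i v = row j v -> w v = 0).

(* (d w)(v_0, ..., v_p) for constant vector fields v_0, ..., v_p, for which   *)
(* the Lie bracket terms vanish.                                              *)
Definition ext_deriv (p : nat) (w : 'rV[R]_n -> 'M[R]_(p, n) -> R)
    (y : 'rV[R]_n) (v : 'M[R]_(p.+1, n)) : R :=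
  \sum_(k < p.+1) (-1) ^+ k * 'D_(row k v) (fun z => w z (row' k v)) y.

Section Metric.
Variable g : 'rV[R]_n -> 'M[R]_n.

Definition christoffel (y : 'rV[R]_n) (i j k : 'I_n) : R :=
  2^-1 * \sum_(l < n) invmx (g y) k l *
    ('D_(e_ i) (fun z => g z j l) y + 'D_(e_ j) (fun z => g z i l) y
     - 'D_(e_ l) (fun z => g z i j) y).

(* The Levi-Civita covariant derivative of the vector field Y along v. *)
Definition covd (Y : 'rV[R]_n -> 'rV[R]_n) (y v : 'rV[R]_n) : 'rV[R]_n :=
  'D_v Y y
  + \row_k \sum_(i < n) \sum_(j < n) christoffel y i j k * v 0 i * Y y 0 j.

Definition grad (f : 'rV[R]_n -> R) (y : 'rV[R]_n) : 'rV[R]_n :=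
  (\row_j 'D_(e_ j) f y) *m invmx (g y).

Definition gram (p : nat) (y : 'rV[R]_n) (v : 'M[R]_(p, n)) : 'M[R]_p :=
  v *m g y *m v^T.

End Metric.

End Calculus.

Record smooth_structure (R : realType) (n : nat) (X : topologicalType) := {
  manifold_hausdorff : hausdorff_space X;
  manifold_second_countable : @second_countable X;
  chart_index : Type;
  chart_dom : chart_index -> set X;
  chart : chart_index -> X -> 'rV[R]_n;
  chart_inv : chart_index -> 'rV[R]_n -> X;
  chart_dom_cover : forall x, exists a, chart_dom a x;
  chart_dom_open : forall a, open (chart_dom a);
  chart_img_open : forall a, open (chart a @` chart_dom a);
  chartK : forall a x, chart_dom a x -> chart_inv a (chart a x) = x;
  chart_continuous : forall a x, chart_dom a x ->
    {for x, continuous (chart a)};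
  chart_inv_continuous : forall a y, (chart a @` chart_dom a) y ->
    {for y, continuous (chart_inv a)};
  transition_smooth : forall a b,
    smooth_on (chart a @` (chart_dom a `&` chart_dom b))
      (chart b \o chart_inv a)
}.

Definition chart_img (R : realType) (n : nat) (X : topologicalType)
    (M : smooth_structure R n X) (a : chart_index M) : set 'rV[R]_n :=
  chart a @` chart_dom a.

(* The matrix taking the coordinates in chart a of a tangent vector at x to  *)
(* its coordinates in chart b.                                                *)
Definition change_mx (R : realType) (n : nat) (X : topologicalType)
    (M : smooth_structure R n X) (a b : chart_index M) (x : X) : 'M[R]_n :=
  'J (chart b \o chart_inv a) (chart a x).

Record riemannian_metric (R : realType) (n : nat) (X : topologicalType)
    (M : smooth_structure R n X) := {
  metric : chart_index M -> 'rV[R]_n -> 'M[R]_n;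
  metric_smooth : forall a, smooth_on (chart_img a) (metric a);
  metric_sym : forall a y, chart_img a y -> (metric a y)^T = metric a y;
  metric_pos : forall a y, chart_img a y -> forall v : 'rV[R]_n, v != 0 ->
    0 < (v *m metric a y *m v^T) 0 0;
  metric_change : forall a b x, chart_dom a x -> chart_dom b x ->
    metric a (chart a x)
    = change_mx a b x *m metric b (chart b x) *m (change_mx a b x)^T
}.

(* A unit simple p-vector v_1 /\ ... /\ v_p is represented by the tuple of    *)
(* rows of v; its squared norm is the Gram determinant det (<v_i, v_j>).      *)
Definition unit_simple (R : realType) (n p : nat) (X : topologicalType)
    (M : smooth_structure R n X) (g : riemannian_metric M)
    (a : chart_index M) (y : 'rV[R]_n) (v : 'M[R]_(p, n)) : Prop :=
  \det (gram (metric g a) y v) = 1.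

Record calibration (R : realType) (n p : nat) (X : topologicalType)
    (M : smooth_structure R n X) (g : riemannian_metric M) := {
  calibration_degree : (1 <= p)%N;
  form : chart_index M -> 'rV[R]_n -> 'M[R]_(p, n) -> R;
  form_alternating : forall a y, chart_img a y -> is_alternating (form a y);
  form_smooth : forall a v, smooth_on (chart_img a) (fun y => form a y v);
  form_change : forall a b x, chart_dom a x -> chart_dom b x ->
    forall v, form a (chart a x) v
              = form b (chart b x) (v *m change_mx a b x);
  form_closed : forall a y, chart_img a y ->
    forall v, ext_deriv (form a) y v = 0;
  form_comass : forall a y, chart_img a y ->
    forall v, unit_simple g a y v -> form a y v <= 1
}.

Section PhiConvexity.
Variables (R : realType) (n p : nat) (X : topologicalType).
Variables (M : smooth_structure R n X) (g : riemannian_metric M).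
Variable phi : calibration p g.
Implicit Type f : X -> R.

Definition smooth_fun f : Prop :=
  forall a : chart_index M, smooth_on (chart_img a) (f \o chart_inv a).

(* Elements of G_x(phi), in the chart a at x. *)
Definition phi_plane (a : chart_index M) (x : X) (v : 'M[R]_(p, n)) : Prop :=
  unit_simple g a (chart a x) v /\ form phi a (chart a x) v = 1.

Definition phi_hessian f (a : chart_index M) (x : X) (v : 'M[R]_(p, n)) : R :=
  let y := chart a x in
  let gradf := grad (metric g a) (f \o chart_inv a) in
  \sum_(i < p)
    form phi a y (set_row v i (covd (metric g a) gradf y (row i v))).

Definition psh f : Prop :=
  smooth_fun f /\
  forall x a, chart_dom a x -> forall v, phi_plane a x v ->
    0 <= phi_hessian f a x v.

Definition strictly_psh_at f (x : X) : Prop :=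
  forall a, chart_dom a x -> forall v, phi_plane a x v ->
    0 < phi_hessian f a x v.

Definition proper_exhaustion f : Prop :=
  forall c : R, compact [set x | f x <= c].

Definition phi_convex : Prop := exists f, psh f /\ proper_exhaustion f.

Definition strictly_phi_convex : Prop :=
  exists f, [/\ smooth_fun f, proper_exhaustion f
              & forall x, strictly_psh_at f x].

Definition strictly_phi_convex_at_infty : Prop :=
  exists f, [/\ psh f, proper_exhaustion f
              & exists K : set X, compact K /\
                  forall x, ~ K x -> strictly_psh_at f x].

Definition W_set f : set X := [set x | ~ strictly_psh_at f x].

Definition core : set X := \bigcap_(f in [set f | psh f]) W_set f.

End PhiConvexity.

(* Main.v *)
Require Import Defs.
From HB Require Import structures.
From mathcomp Require Import all_boot all_order all_algebra.
From mathcomp Require Import all_classical all_reals all_analysis.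
From mathcomp Require Import ring lra.

(** The two implications that start from a strict exhaustion are soft: the set
    W(f) is closed for every smooth f, so the core is closed, and it lies
    inside the compact set outside which the given exhaustion is strict.

    For the converses, fix a plurisubharmonic proper exhaustion h.  Every point
    x off the core has a plurisubharmonic f that is strict at x, hence strict
    near x ([strictly_psh_near]).  If theta is smooth with theta', theta'' >= 0,
    then theta o f is again plurisubharmonic, and strict where f is strict and
    theta'(f) > 0 ([phi_hessian_comp_ge]): the new term in its Hessian is
    theta''(f) times the trace of df (x) grad f on a calibrated plane, which by
    the first cousin principle equals the squared length of the tangential part
    of grad f ([first_cousin], [phi_plane_trace_ge0]).

    Take theta(t) = t exp(-1/t) for t > 0 and theta(t) = 0 for t <= 0
    ([hinge]), a smooth convex function.  It first makes the f above
    nonnegative, so that finite sums give, for each compact set K off the core,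
    a nonnegative plurisubharmonic f strict on K ([compact_strict]).  If the
    core lies in {h < 0}, apply this to the shells {0 <= h <= k + 1}; scale the
    result so that f_k <= 1/2 on {h <= k + 1}, and put

        F = sum over k of theta (h + f_k - k + 1/2).

    The k-th term vanishes on {h <= k - 1} and is strict on {k <= h <= k + 1},
    so the sum is locally finite, nonnegative, and strict on {h >= 0}
    ([strict_above_core]).  Then h + F is a proper exhaustion strict on
    {h >= 0}; when the core is empty one more nonnegative function, strict on
    the compact set {h <= 0}, makes it strict everywhere.  These arguments use
    only a few closure properties of the pair (plurisubharmonic functions,
    points of strictness), isolated in [convex_cone].

    The geometric input is that strictness is an open condition.  Strictness at
    x quantifies over all charts at x, so the Hessian must be shown to be
    independent of the chart: [hess_tau] is the tensoriality of
    D_v D_w f - Gamma(v, w, grad f), which rests on the symmetry of second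
    derivatives.  In a single chart, the tuples v with Gram determinant 1 are
    not bounded, but a triangular matrix of determinant 1 turns v into an
    orthonormal tuple without changing the value of any alternating form
    ([cholesky], [alt_trig], [orthonormalize]); both the calibration and the
    Hessian form are alternating, and orthonormal tuples form a locally bounded
    family, so compactness applies ([positive_planes_near]). *)

Set Implicit Arguments.
Unset Strict Implicit.
Unset Printing Implicit Defensive.

Import Order.TTheory GRing.Theory Num.Theory.
Import numFieldNormedType.Exports.

Local Open Scope classical_set_scope.
Local Open Scope ring_scope.

(** * Smooth functions on open sets of R^n *)

Section Differentiability.
Variable R : realType.

Lemma near_eq_differentiable (V W : normedModType R) (f g : V -> W) (x : V) :
  (\forall z \near x, f z = g z) -> differentiable f x -> differentiable g x.
Proof.
move=> fg df.
have fgx : f x = g x by exact: nbhs_singleton fg.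
have eqg : g \o shift x = cst (g x) + 'd f x +o_ 0 id.
  apply/eqaddoP => e e0.
  have /eqaddoP/(_ e e0) := diff_locally df.
  have {}fg : \forall h \near (0 : V), f (h + x) = g (h + x).
    by move: fg; rewrite (near_shift 0 x) subr0.
  apply: filterS2 fg => h /= fgh; rewrite ![(_ - _) _]/= !fctE /= -fgx.
  by rewrite -fgh.
have cd : continuous ('d f x) by exact: diff_continuous.
by apply/diff_locallyP; rewrite (diff_unique cd eqg).
Qed.

Lemma is_derive_line (V W : normedModType R) (u : V -> W) (c v : V) (s : R) :
  differentiable u (c + s *: v) ->
  is_derive s 1 (fun s : R => u (c + s *: v)) ('D_v u (c + s *: v)).
Proof.
move=> du.
have dl : is_diff s (fun s : R => c + s *: v) ( *:%R^~ v).
  have := is_diffD (is_diff_cst c s) (is_diff_scalel s v).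
  by rewrite add0r.
have dl' : differentiable (fun s : R => c + s *: v) s by case: dl.
have dul := differentiable_comp dl' du.
apply: DeriveDef; first exact: diff_derivable.
rewrite (deriveE _ dul) diff_comp //= (deriveE _ du).
by rewrite (diff_val (is_diff_def := dl)) scale1r.
Qed.

Lemma derive_comp_diff (U V W : normedModType R) (f : U -> V) (g : V -> W)
    (x v : U) :
  differentiable f x -> differentiable g (f x) ->
  'D_v (g \o f) x = 'D_('D_v f x) g (f x).
Proof.
move=> df dg; rewrite !deriveE //; last exact: differentiable_comp.
by rewrite diff_comp.
Qed.

End Differentiability.

Section Smooth.
Variables (R : realType) (n : nat).
Implicit Types (V : set 'rV[R]_n) (W : normedModType R).

Lemma iter_partial_rcons W (f : 'rV[R]_n -> W) s i :
  iter_partial f (rcons s i) = iter_partial (fun y => 'D_(e_ R i) f y) s.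
Proof. by rewrite /iter_partial foldr_rcons. Qed.

Lemma iter_partial_near W (f h : 'rV[R]_n -> W) s (y : 'rV[R]_n) :
  (\forall z \near y, f z = h z) ->
  \forall z \near y, iter_partial f s z = iter_partial h s z.
Proof.
move=> fh; elim: s => [//|i s IH] /=.
move: IH => /near_join; apply: filterS => z fhz.
exact: near_eq_derive.
Qed.

Lemma open_near_eq W V (f h : 'rV[R]_n -> W) y : open V -> V y ->
  (forall z, V z -> f z = h z) -> \forall z \near y, f z = h z.
Proof. by move=> oV Vy fh; apply: filterS (open_nbhs_nbhs (conj oV Vy)). Qed.

(** Smoothness by coinduction: a class of differentiable functions that is
    stable, up to equality on V, under partial derivatives consists of smooth
    functions. *)
Lemma smooth_on_coind W V (P : ('rV[R]_n -> W) -> Prop) : open V ->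
  (forall f, P f -> forall y, V y -> differentiable f y) ->
  (forall f i, P f ->
     exists2 h, P h & forall y, V y -> 'D_(e_ R i) f y = h y) ->
  forall f, P f -> smooth_on V f.
Proof.
move=> oV dP DP f Pf s; elim/last_ind: s f Pf => [|s i IH] f Pf y Vy.
  exact: dP.
have [h Ph Dh] := DP f i Pf; rewrite iter_partial_rcons.
apply: near_eq_differentiable (IH h Ph y Vy).
apply: iter_partial_near; apply: open_near_eq oV Vy _ => z Vz.
by rewrite Dh.
Qed.

Lemma smooth_on_local W V (f : 'rV[R]_n -> W) :
  (forall y, V y -> exists (U : set 'rV[R]_n) h,
     [/\ U y, smooth_on U h & \forall z \near y, f z = h z]) ->
  smooth_on V f.
Proof.
move=> loc s y Vy; have [U [h [Uy sh fh]]] := loc y Vy.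
apply: near_eq_differentiable (sh s y Uy); apply: iter_partial_near.
by apply: filterS fh => z ->.
Qed.

Lemma smooth_on_sub W V V' (f : 'rV[R]_n -> W) :
  V' `<=` V -> smooth_on V f -> smooth_on V' f.
Proof. by move=> VV sf s y /VV; exact: sf. Qed.

Lemma smooth_on_differentiable W V (f : 'rV[R]_n -> W) y :
  smooth_on V f -> V y -> differentiable f y.
Proof. by move=> sf; exact: (sf [::]). Qed.

Lemma smooth_on_partial W V (f : 'rV[R]_n -> W) i :
  smooth_on V f -> smooth_on V (fun y => 'D_(e_ R i) f y).
Proof. by move=> sf s y Vy; rewrite -iter_partial_rcons; exact: sf. Qed.

Lemma smooth_on_cst W V (c : W) : open V -> smooth_on V (cst c : 'rV[R]_n -> W).
Proof.
move=> oV; apply: (@smooth_on_coind _ _ (fun f => exists c, f = cst c)) => //.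
- by move=> _ [d ->] y _; exact: differentiable_cst.
- move=> _ i [d ->]; exists (cst 0); first by exists 0.
  by move=> y _; rewrite derive_cst.
- by exists c.
Qed.

Lemma smooth_on_cstr V (c : R) : open V -> smooth_on V (fun=> c : R).
Proof. exact: smooth_on_cst. Qed.

(** Differentiating one of these operations involves the others, so only the
    class generated by all of them is stable under partial derivatives.  The
    sequence [th] lists a function of one real variable and its derivatives. *)
Inductive smooth_expr V : ('rV[R]_n -> R) -> Prop :=
| SE_base f : smooth_on V f -> smooth_expr V f
| SE_add f h : smooth_expr V f -> smooth_expr V h ->
    smooth_expr V (fun y => f y + h y)
| SE_mul f h : smooth_expr V f -> smooth_expr V h ->
    smooth_expr V (fun y => f y * h y)
| SE_inv (f : 'rV[R]_n -> R) : smooth_on V f -> (forall y, V y -> f y != 0) ->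
    smooth_expr V (fun y => (f y)^-1)
| SE_comp (th : nat -> R -> R) j (f : 'rV[R]_n -> R) :
    (forall k (t : R), is_derive t 1 (th k) (th k.+1 t)) -> smooth_on V f ->
    smooth_expr V (fun y => th j (f y)).

Lemma is_derive_comp_real (f : 'rV[R]_n -> R) (th : R -> R) (c : R)
    (y v : 'rV[R]_n) :
  is_derive (f y) 1 th c -> differentiable f y ->
  'D_v (fun z => th (f z)) y = c * 'D_v f y.
Proof.
move=> dth df; have dth' : differentiable th (f y).
  by apply/derivable1_diffP; exact: ex_derive.
rewrite (derive_comp_diff (g := th)) // (deriveE _ dth').
rewrite -[X in 'd th _ X]mulr1 [LHS]linearZ /= -deriveE //.
by rewrite derive_val [_ *: _]mulrC.
Qed.

Lemma smooth_exprP V f : open V -> smooth_expr V f -> smooth_on V f.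
Proof.
move=> oV; apply: smooth_on_coind => // {f}.
  move=> f; elim=> {f}.
  - by move=> f sf y Vy; exact: smooth_on_differentiable sf Vy.
  - by move=> f h _ df _ dh y Vy; apply: differentiableD; [exact: df|exact: dh].
  - by move=> f h _ df _ dh y Vy; apply: differentiableM; [exact: df|exact: dh].
  - move=> f sf nz y Vy; apply: differentiableV; last exact: nz.
    exact: smooth_on_differentiable sf Vy.
  - move=> th j f dth sf y Vy; apply: (differentiable_comp (g := th j)).
      exact: smooth_on_differentiable sf Vy.
    by apply/derivable1_diffP; exact: ex_derive.
suff : forall f, smooth_expr V f ->
    (forall y, V y -> differentiable f y) /\ forall i,
    exists2 h : 'rV_n -> R, smooth_expr V h & forall y, V y -> 'D_(e_ R i) f y = h y.
  by move=> H f i /H[_]; exact.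
move=> f; elim=> {f}.
- move=> f sf; split=> [y|i]; first exact: smooth_on_differentiable.
  by exists (fun y => 'D_(e_ R i) f y) => //; apply: SE_base; exact: smooth_on_partial.
- move=> f h _ [df Df] _ [dh Dh]; split=> [y Vy|i].
    by apply: differentiableD; [exact: df|exact: dh].
  have [f' sf' ef] := Df i; have [h' sh' eh] := Dh i.
  exists (fun y => f' y + h' y); first exact: SE_add.
  move=> y Vy; rewrite -ef // -eh //.
  by rewrite -deriveD //; apply: diff_derivable; [exact: df|exact: dh].
- move=> f h sf [df Df] sh [dh Dh]; split=> [y Vy|i].
    by apply: differentiableM; [exact: df|exact: dh].
  have [f' sf' ef] := Df i; have [h' sh' eh] := Dh i.
  exists (fun y => f y * h' y + h y * f' y).
    by apply: SE_add; apply: SE_mul.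
  move=> y Vy; rewrite -ef // -eh //.
  rewrite -[LHS]/('D_(e_ R i) (f * h) y) deriveM //; apply: diff_derivable.
    exact: df.
  exact: dh.
- move=> f sf nz; split=> [y Vy|i].
    by apply: differentiableV; [exact: smooth_on_differentiable sf Vy|exact: nz].
  exists (fun y => -1 * ((f y)^-1 * (f y)^-1) * 'D_(e_ R i) f y).
    apply: SE_mul; last by apply: SE_base; exact: smooth_on_partial.
    apply: SE_mul; first by apply: SE_base; exact: smooth_on_cstr.
    by apply: SE_mul; exact: SE_inv.
  move=> y Vy; rewrite deriveV; [|exact: nz|].
    by rewrite -[_ *: _]/(_ * _) mulN1r -expr2 exprVn.
  by apply: diff_derivable; exact: smooth_on_differentiable sf Vy.
- move=> th j f dth sf; split=> [y Vy|i].
    apply: (differentiable_comp (g := th j)).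
      exact: smooth_on_differentiable sf Vy.
    by apply/derivable1_diffP; exact: ex_derive.
  exists (fun y => th j.+1 (f y) * 'D_(e_ R i) f y).
    apply: SE_mul; first exact: SE_comp.
    by apply: SE_base; exact: smooth_on_partial.
  move=> y Vy; apply: is_derive_comp_real => //.
  exact: smooth_on_differentiable sf Vy.
Qed.

Section Closure.
Variable V : set 'rV[R]_n.
Hypothesis oV : open V.
Implicit Types f h : 'rV[R]_n -> R.

Lemma smooth_onD f h : smooth_on V f -> smooth_on V h ->
  smooth_on V (fun y => f y + h y).
Proof. by move=> sf sh; apply: smooth_exprP => //; apply: SE_add; apply: SE_base. Qed.

Lemma smooth_onM f h : smooth_on V f -> smooth_on V h ->
  smooth_on V (fun y => f y * h y).
Proof. by move=> sf sh; apply: smooth_exprP => //; apply: SE_mul; apply: SE_base. Qed.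

Lemma smooth_onV f : smooth_on V f -> (forall y, V y -> f y != 0) ->
  smooth_on V (fun y => (f y)^-1).
Proof. by move=> sf nz; apply: smooth_exprP => //; exact: SE_inv. Qed.

Lemma smooth_on_comp (th : nat -> R -> R) f :
  (forall k (t : R), is_derive t 1 (th k) (th k.+1 t)) -> smooth_on V f ->
  smooth_on V (fun y => th 0%N (f y)).
Proof. by move=> dth sf; apply: smooth_exprP => //; exact: SE_comp. Qed.

Lemma smooth_on_sum (I : Type) (r : seq I) (P : pred I)
    (F : I -> 'rV[R]_n -> R) : (forall i, P i -> smooth_on V (F i)) ->
  smooth_on V (fun y => \sum_(i <- r | P i) F i y).
Proof.
move=> sF; elim: r => [|i r IH].
  by under eq_fun do rewrite big_nil; exact: smooth_on_cstr.
under eq_fun do rewrite big_cons.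
have [Pi|_] := boolP (P i) => //.
by apply: smooth_onD => //; exact: sF.
Qed.

Lemma smooth_on_prod (I : Type) (r : seq I) (P : pred I)
    (F : I -> 'rV[R]_n -> R) : (forall i, P i -> smooth_on V (F i)) ->
  smooth_on V (fun y => \prod_(i <- r | P i) F i y).
Proof.
move=> sF; elim: r => [|i r IH].
  by under eq_fun do rewrite big_nil; exact: smooth_on_cstr.
under eq_fun do rewrite big_cons.
have [Pi|_] := boolP (P i) => //.
by apply: smooth_onM => //; exact: sF.
Qed.

End Closure.

Lemma derive_entry k l (A : 'rV[R]_n -> 'M[R]_(k, l)) y v i j :
  derivable A y v -> 'D_v (fun z => A z i j) y = 'D_v A y i j.
Proof. by move=> dA; rewrite derive_mx // mxE. Qed.

Lemma smooth_on_entry V k l (A : 'rV[R]_n -> 'M[R]_(k, l)) i j : open V ->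
  smooth_on V A -> smooth_on V (fun y => A y i j).
Proof.
move=> oV sA.
apply: (@smooth_on_coind _ _ (fun f => exists2 B, smooth_on V B &
    f = fun y => (B y : 'M[R]_(k, l)) i j)) => //; last by exists A.
- move=> _ [B sB ->] y Vy.
  apply: (differentiable_comp (g := fun M : 'M[R]_(k, l) => M i j)).
    exact: smooth_on_differentiable sB Vy.
  exact: differentiable_coord.
- move=> _ a [B sB ->]; exists (fun y => 'D_(e_ R a) B y i j).
    by exists (fun y => 'D_(e_ R a) B y) => //; exact: smooth_on_partial.
  move=> y Vy; rewrite derive_entry //; apply: diff_derivable.
  exact: smooth_on_differentiable sB Vy.
Qed.

(** Entrywise smoothness: it is the form in which products and inverses are
    handled, and it yields derivability of matrix-valued functions. *)
Definition smooth_mx V k l (A : 'rV[R]_n -> 'M[R]_(k, l)) : Prop :=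
  forall i j, smooth_on V (fun y => A y i j).

Lemma smooth_mxM V k l m (A : 'rV[R]_n -> 'M[R]_(k, l))
    (B : 'rV[R]_n -> 'M[R]_(l, m)) : open V ->
  smooth_mx V A -> smooth_mx V B -> smooth_mx V (fun y => A y *m B y).
Proof.
move=> oV sA sB i j; under eq_fun do rewrite mxE.
by apply: smooth_on_sum => // a _; exact: smooth_onM.
Qed.

Lemma smooth_on_det V k (A : 'rV[R]_n -> 'M[R]_k) : open V ->
  smooth_mx V A -> smooth_on V (fun y => \det (A y)).
Proof.
move=> oV sA; rewrite /determinant; apply: smooth_on_sum => // s _.
apply: smooth_onM => //; first exact: smooth_on_cstr.
by apply: smooth_on_prod => // i _; exact: sA.
Qed.

Lemma smooth_mx_inv V k (A : 'rV[R]_n -> 'M[R]_k) : open V ->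
  smooth_mx V A -> (forall y, V y -> A y \in unitmx) ->
  smooth_mx V (fun y => invmx (A y)).
Proof.
move=> oV sA uA i j.
apply: (@smooth_on_local _ _ _) => y Vy.
exists V, (fun z => (\det (A z))^-1 * cofactor (A z) j i); split => //; last first.
  apply: (open_near_eq oV Vy) => z Vz.
  by rewrite /invmx uA // !mxE.
apply: smooth_onM => //.
  apply: smooth_onV => //; first exact: smooth_on_det.
  by move=> z Vz; rewrite -unitfE -[_ \is a _]/(A z \in unitmx) uA.
rewrite /cofactor; apply: smooth_onM => //.
  exact: smooth_on_cstr.
apply: smooth_on_det => // a b.
by under eq_fun do rewrite !mxE; exact: sA.
Qed.

Lemma derive_dir W (f : 'rV[R]_n -> W) y v : differentiable f y ->
  'D_v f y = \sum_i v 0 i *: 'D_(e_ R i) f y.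
Proof.
move=> df; rewrite deriveE // {1}(row_sum_delta v) linear_sum /=.
by apply: eq_bigr => i _; rewrite linearZ /= -deriveE.
Qed.

Lemma smooth_on_dir V (f : 'rV[R]_n -> R) v : open V ->
  smooth_on V f -> smooth_on V (fun y => 'D_v f y).
Proof.
move=> oV sf; apply: smooth_on_local => y Vy.
exists V, (fun z => \sum_i v 0 i * 'D_(e_ R i) f z); split => //.
  apply: smooth_on_sum => // i _; apply: smooth_onM => //.
    exact: smooth_on_cstr.
  exact: smooth_on_partial.
apply: (open_near_eq oV Vy) => z Vz; apply: derive_dir.
exact: smooth_on_differentiable sf Vz.
Qed.

Lemma subrACA (a b c d : R) : a - b - (c - d) = a - c - (b - d).
Proof. ring. Qed.

Lemma dist_split (e a b a' b' : R) : a' = b' ->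
  `|a - a'| < e / 2 -> `|b - b'| < e / 2 -> `|a - b| <= e.
Proof.
move=> -> aa bb; rewrite (_ : a - b = (a - b') - (b - b')); last by ring.
by apply: le_trans (ler_normB _ _) _; rewrite (splitr e) lerD // ltW.
Qed.

(** Two applications of the mean value theorem.  The second difference on the
    left is symmetric in v and w, which yields the symmetry of second
    derivatives. *)
Lemma second_difference V (u : 'rV[R]_n -> R) c v w (h : R) : open V ->
  smooth_on V u -> 0 < h ->
  (forall s t, 0 <= s <= h -> 0 <= t <= h -> V (c + s *: v + t *: w)) ->
  exists s t, [/\ 0 <= s <= h, 0 <= t <= h &
   u (c + h *: v + h *: w) - u (c + h *: v) - (u (c + h *: w) - u c)
   = h ^+ 2 * 'D_w (fun z => 'D_v u z) (c + s *: v + t *: w)].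
Proof.
move=> oV su h0 Vh.
have hh : 0 <= h <= h by rewrite ltW //=.
have h00 : (0 : R) <= 0 <= h by apply/andP; split; [|exact: ltW].
pose k s := u (c + h *: w + s *: v) - u (c + s *: v).
have dk s : 0 <= s <= h ->
    is_derive s 1 k ('D_v u (c + h *: w + s *: v) - 'D_v u (c + s *: v)).
  move=> sh; apply: is_deriveB; apply: is_derive_line.
    apply: smooth_on_differentiable su _.
    by rewrite addrAC; apply: Vh.
  apply: smooth_on_differentiable su _.
  by have := Vh s 0 sh h00; rewrite scale0r addr0.
have itv x : x \in `]0, h[ -> 0 <= x <= h.
  by rewrite in_itv /= => /andP[/ltW-> /ltW->].
have kc : {within `[0, h], continuous k}.
  apply: derivable_within_continuous => x; rewrite in_itv /= => xh.
  by have := dk x xh; case.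
have [s sh es] := MVT h0 (fun x xh => dk x (itv x xh)) kc.
have {}sh := itv _ sh.
pose m t := 'D_v u (c + s *: v + t *: w).
have sDv := smooth_on_dir v oV su.
have dm t : 0 <= t <= h ->
    is_derive t 1 m ('D_w (fun z => 'D_v u z) (c + s *: v + t *: w)).
  move=> th; apply: (is_derive_line (u := fun z => 'D_v u z)).
  by apply: smooth_on_differentiable sDv _; exact: Vh.
have mc : {within `[0, h], continuous m}.
  apply: derivable_within_continuous => x; rewrite in_itv /= => xh.
  by have := dm x xh; case.
have [t th et] := MVT h0 (fun x xh => dm x (itv x xh)) mc.
have {}th := itv _ th.
exists s, t; split=> //.
transitivity (k h - k 0).
  by rewrite /k !scale0r !addr0 (addrAC c).
rewrite es subr0.
have -> : c + h *: w + s *: v = c + s *: v + h *: w by rewrite addrAC.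
move: et; rewrite /m scale0r addr0 => ->.
by rewrite subr0 expr2; ring.
Qed.

(** Both second derivatives are limits of the same second difference divided
    by the square of the step. *)
Lemma smooth_on_schwarz V (u : 'rV[R]_n -> R) y v w : open V -> V y ->
  smooth_on V u ->
  'D_v (fun z => 'D_w u z) y = 'D_w (fun z => 'D_v u z) y.
Proof.
move=> oV Vy su; apply/eqP; rewrite -subr_eq0 -normr_le0.
apply/ler_addgt0Pl => e e0; rewrite addr0.
have e20 : 0 < e / 2 by rewrite divr_gt0.
pose A z := 'D_v (fun z => 'D_w u z) z.
pose B z := 'D_w (fun z => 'D_v u z) z.
have cA : {for y, continuous A}.
  apply: differentiable_continuous; apply: (smooth_on_differentiable (V := V)) => //.
  by apply: smooth_on_dir => //; exact: smooth_on_dir.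
have cB : {for y, continuous B}.
  apply: differentiable_continuous; apply: (smooth_on_differentiable (V := V)) => //.
  by apply: smooth_on_dir => //; exact: smooth_on_dir.
have := open_nbhs_nbhs (conj oV Vy).
move/cvgrPdist_lt: cA => /(_ _ e20) nA.
move/cvgrPdist_lt: cB => /(_ _ e20) nB nV.
have /nbhs_ballP[d /= d0 dball] : nbhs y (V `&`
    ([set t | `|A y - A t| < e / 2] `&` [set t | `|B y - B t| < e / 2])).
  by apply: filterI nV _; exact: filterI nA nB.
(* The summand 1 avoids dividing by zero when v = w = 0. *)
pose N := `|v| + `|w| + 1.
have N0 : 0 < N by rewrite ltr_wpDl // addr_ge0.
pose h := d / 2 / N.
have h0 : 0 < h by rewrite !divr_gt0.
have inb s t : 0 <= s <= h -> 0 <= t <= h -> ball y d (y + s *: v + t *: w).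
  move=> /andP[s0 sh] /andP[t0 th]; rewrite -ball_normE /ball_ /=.
  rewrite -addrA opprD addrA subrr add0r normrN.
  apply: le_lt_trans (ler_normD _ _) _; rewrite !normrZ !ger0_norm //.
  apply: (@le_lt_trans _ _ (h * (`|v| + `|w|))).
    by rewrite mulrDr lerD // ler_wpM2r.
  apply: (@le_lt_trans _ _ (h * N)).
    by apply: ler_wpM2l; [exact: ltW|rewrite lerDl].
  by rewrite /h divfK ?gt_eqF // ltr_pdivrMr // ltr_pMr // ltr1n.
have [s [t [sh th e1]]] := second_difference (c := y) (v := v) (w := w) oV su h0
   (fun s t sh th => (dball _ (inb s t sh th)).1).
have inb' s' t' : 0 <= s' <= h -> 0 <= t' <= h -> V (y + s' *: w + t' *: v).
  by move=> sh' th'; rewrite addrAC; apply: (dball _ (inb _ _ th' sh')).1.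
have [s' [t' [sh' th' e2]]] := second_difference (c := y) (v := w) (w := v)
   oV su h0 inb'.
have AB : A (y + t' *: v + s' *: w) = B (y + s *: v + t *: w).
  apply: (@mulfI _ (h ^+ 2)); first by rewrite expf_neq0 // gt_eqF.
  have -> : y + t' *: v + s' *: w = y + s' *: w + t' *: v by rewrite addrAC.
  by rewrite -[LHS]e2 -[RHS]e1 subrACA (addrAC y (h *: w)).
have [_ [dA _]] := dball _ (inb _ _ th' sh').
have [_ [_ dB]] := dball _ (inb _ _ sh th).
exact: dist_split AB dA dB.
Qed.

End Smooth.

(** * A smooth convex function vanishing exactly on the nonpositive half-line *)

Section Flat.
Variable R : realType.
Implicit Types (P : {poly R}) (t x : R).

Lemma powM_expRN_bound k x : 0 <= x -> x ^+ k * expR (- x) <= k`!%:R.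
Proof.
move=> x0; rewrite expRN ler_pdivrMr ?expR_gt0 //.
case: k => [|k].
  rewrite expr0 fact0 mul1r -[leLHS]addr0.
  by apply: le_trans (expR_ge1Dx x); rewrite lerD2l.
rewrite mulrC -ler_pdivrMr ?ltr0n ?fact_gt0 //.
by apply: le_trans (expR_ge1Dxn k x0); rewrite lerDr.
Qed.

(** The exponential dominates every polynomial. *)
Lemma poly_expRN_bound P : exists C, forall x, 0 <= x ->
  `|P.[x]| * expR (- x) <= C.
Proof.
exists (\sum_(i < size P) `|P`_i| * i`!%:R) => x x0.
rewrite horner_coef.
apply: (@le_trans _ _ ((\sum_(i < size P) `|P`_i| * x ^+ i) * expR (- x))).
  rewrite ler_wpM2r ?expR_ge0 //; apply: le_trans (ler_norm_sum _ _ _) _.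
  by apply: ler_sum => i _; rewrite normrM normrX (ger0_norm x0).
rewrite mulr_suml; apply: ler_sum => i _.
by rewrite -mulrA ler_wpM2l // powM_expRN_bound.
Qed.

(** P(1/t) exp(-1/t) extended by zero: a family closed under derivation. *)
Definition flat P t : R := if 0 < t then P.[t^-1] * expR (- t^-1) else 0.

Lemma flat_pos P t : 0 < t -> flat P t = P.[t^-1] * expR (- t^-1).
Proof. by rewrite /flat => ->. Qed.

Lemma flat_npos P t : t <= 0 -> flat P t = 0.
Proof. by rewrite /flat ltNge => ->. Qed.

(** A bound by t^2 gives derivative 0 at the origin; the factor t^2 is absorbed
    by bounding X^2 P in place of P. *)
Lemma flat_bound P : exists2 C, 0 <= C & forall t, `|flat P t| <= C * t ^+ 2.
Proof.
have [C PC] := poly_expRN_bound ('X^2 * P).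
have C0 : 0 <= C by apply: le_trans (PC 0 (lexx _)); rewrite mulr_ge0 // expR_ge0.
exists C => // t.
have [t0|t0] := leP t 0; first by rewrite flat_npos // normr0 mulr_ge0 // sqr_ge0.
have i0 : 0 <= t^-1 by rewrite invr_ge0 ltW.
have h2 : `|('X^2 * P).[t^-1]| = t^-1 ^+ 2 * `|P.[t^-1]|.
  by rewrite hornerM hornerXn normrM (ger0_norm (exprn_ge0 2 i0)).
have := PC _ i0; rewrite h2 flat_pos // normrM (ger0_norm (expR_ge0 _)).
rewrite exprVn -mulrA.
by rewrite mulrC ler_pdivrMr // exprn_gt0.
Qed.

Lemma is_derive_square_bound (f : R -> R) C :
  (forall t, `|f t| <= C * t ^+ 2) -> is_derive (0 : R) 1 f 0.
Proof.
move=> fC.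
have f0 : f 0 = 0.
  by apply/eqP; rewrite -normr_le0; apply: le_trans (fC 0) _; rewrite expr0n mulr0.
have lim0 : (fun h : R => h^-1 *: (f (h *: 1 + 0) - f 0)) @ 0^' --> (0 : R).
  apply/cvgrPdist_lt => e e0.
  have C1 : 0 < `|C| + 1 by rewrite ltr_wpDl.
  near=> h.
  have hn0 : h != 0 by near: h; exact: nbhs_dnbhs_neq.
  have he : `|h| < e / (`|C| + 1).
    by near: h; apply: dnbhs0_lt; rewrite divr_gt0.
  rewrite f0 subr0 addr0 sub0r normrN /= [h *: 1]mulr1 normrM normfV.
  have hh : 0 < `|h| by rewrite normr_gt0.
  rewrite mulrC ltr_pdivrMr //; apply: le_lt_trans (fC h) _.
  rewrite -(real_normK (num_real h)) expr2 mulrA ltr_pM2r //.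
  apply: (@le_lt_trans _ _ ((`|C| + 1) * `|h|)).
    by rewrite ler_pM2r // ler_wpDr // ler_norm.
  by rewrite mulrC -ltr_pdivlMr.
apply: DeriveDef; first by apply/cvg_ex; exists 0.
exact/cvg_lim.
Unshelve. all: by end_near. Qed.

Lemma near_pos (t : R) : 0 < t -> \forall s \near t, 0 < s.
Proof. by move=> t0; exact: (open_nbhs_nbhs (conj (@open_gt R 0) t0)). Qed.

Lemma near_neg (t : R) : t < 0 -> \forall s \near t, s < 0.
Proof. by move=> t0; exact: (open_nbhs_nbhs (conj (@open_lt R 0) t0)). Qed.

Lemma is_derive_inv t : t != 0 -> is_derive t 1 (fun s : R => s^-1) (- t ^- 2).
Proof.
move=> t0; have := @is_deriveV _ id t 1 1 t0 (is_derive_id _ _).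
by rewrite [_ *: _]mulr1.
Qed.

Lemma is_derive_expR_inv t : 0 < t ->
  is_derive t 1 (fun s => expR (- s^-1)) (t^-1 ^+ 2 * expR (- t^-1)).
Proof.
move=> t0; have dN := is_deriveN (is_derive_inv (lt0r_neq0 t0)).
have := @is_derive1_comp _ expR _ t _ _ (is_derive_expR _) dN.
by rewrite opprK -exprVn mulrC.
Qed.

Lemma is_derive_flat P t :
  is_derive t 1 (flat P) (flat ('X^2 * (P - P^`())) t).
Proof.
have [t0|t0|->] := ltgtP t 0.
- rewrite flat_npos ?ltW //.
  apply: near_eq_is_derive (is_derive_cst 0 t 1).
  by apply: filterS (near_neg t0) => s s0; rewrite flat_npos // ltW.
- have di := is_derive_inv (lt0r_neq0 t0).
  have dP := @is_derive1_comp _ (horner P) _ t _ _ (is_derive_poly P t^-1) di.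
  have dPe := is_deriveM dP (is_derive_expR_inv t0).
  apply: (@near_eq_is_derive _ _ _
    ((horner P \o GRing.inv) * (fun s => expR (- s^-1)))).
    by apply: filterS (near_pos t0) => s s0; rewrite flat_pos.
  apply: is_derive_eq dPe _; rewrite flat_pos // hornerM hornerXn hornerD hornerN.
  transitivity (P.[t^-1] * (t^-1 ^+ 2 * expR (- t^-1))
      + expR (- t^-1) * (P^`().[t^-1] * - (t^-1 ^+ 2))); first by rewrite exprVn.
  ring.
- rewrite flat_npos //; have [C _ PC] := flat_bound P.
  exact: is_derive_square_bound PC.
Qed.

Definition flat_poly (k : nat) : {poly R} :=
  iter k (fun P => 'X^2 * (P - P^`())) (1 + 'X).

(** The k-th derivative of t exp(-1/t), extended by zero to t <= 0.  The extra
    factor t makes the function convex on the whole line: its second derivative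
    is t^-3 exp(-1/t), whereas exp(-1/t) itself is concave for t > 1/2. *)
Definition hinge (k : nat) t : R :=
  if k is j.+1 then flat (flat_poly j) t else t * flat 1 t.

Lemma is_derive_hinge k t : is_derive t 1 (hinge k) (hinge k.+1 t).
Proof.
case: k => [|k]; last exact: is_derive_flat.
have := is_deriveM (is_derive_id t 1) (is_derive_flat 1 t).
move=> H; have -> : hinge 0 = id * flat 1 by [].
apply: is_derive_eq H _; rewrite /hinge /= poly.derivE subr0 mulr1.
have [t0|t0] := leP t 0; first by rewrite !flat_npos // scaler0 scale0r addr0.
rewrite !flat_pos // hornerXn hornerD hornerX hornerC.
transitivity (t * (t^-1 ^+ 2 * expR (- t^-1)) + expR (- t^-1)).
  by rewrite mul1r; congr (_ + _); exact: mulr1.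
have tn0 : t != 0 by rewrite gt_eqF.
by field.
Qed.

Lemma hinge_npos k t : t <= 0 -> hinge k t = 0.
Proof. by case: k => [|k] t0; rewrite /hinge flat_npos // mulr0. Qed.

Lemma hinge0_ge0 t : 0 <= hinge 0 t.
Proof.
have [t0|t0] := leP t 0; first by rewrite hinge_npos.
by rewrite /hinge flat_pos // hornerC mul1r mulr_ge0 ?expR_ge0 // ltW.
Qed.

Lemma hinge1_gt0 t : 0 < t -> 0 < hinge 1 t.
Proof.
move=> t0; rewrite /hinge flat_pos // hornerD hornerX hornerC.
by rewrite mulr_gt0 ?expR_gt0 // addr_gt0 // invr_gt0.
Qed.

Lemma hinge1_ge0 t : 0 <= hinge 1 t.
Proof.
by have [t0|/hinge1_gt0/ltW//] := leP t 0; rewrite hinge_npos.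
Qed.

Lemma hinge2_ge0 t : 0 <= hinge 2 t.
Proof.
have [t0|t0] := leP t 0; first by rewrite hinge_npos.
rewrite /hinge flat_pos // /flat_poly /= !poly.derivE.
rewrite mulr_ge0 ?expR_ge0 //.
have i0 : 0 <= t^-1 by rewrite invr_ge0 ltW.
rewrite add0r (addrC 1) addrK hornerM hornerXn hornerX.
by rewrite mulr_ge0 ?exprn_ge0.
Qed.

(** The k-th derivative of the affine function a t + b. *)
Definition affine (a b : R) (k : nat) t : R :=
  match k with 0 => a * t + b | 1 => a | _ => 0 end.

Lemma is_derive_affine a b k t : is_derive t 1 (affine a b k) (affine a b k.+1 t).
Proof.
case: k => [|[|k]] /=; [|exact: is_derive_cst..].
have := is_deriveD (is_deriveZ a (is_derive_id t 1)) (is_derive_cst b t 1).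
move=> H; have -> : affine a b 0 = a \*: id + cst b by [].
by apply: is_derive_eq H _; rewrite addr0 [_ *: _]mulr1.
Qed.

End Flat.

(** * The covariant Hessian of a function and its invariance *)

(* Unification would otherwise unfold directional derivatives to limits. *)
#[local] Opaque derive.

Section Bilinear.
Variables (R : realType) (n : nat).
Implicit Types (A B : 'M[R]_n) (v w u : 'rV[R]_n).

Definition bil A v w : R := (v *m A *m w^T) 0 0.

Lemma bilE A v w : bil A v w = \sum_i \sum_j v 0 i * A i j * w 0 j.
Proof.
rewrite /bil mxE exchange_big /=; apply: eq_bigr => j _.
by rewrite !mxE mulr_suml; apply: eq_bigr.
Qed.

Lemma bilDl A u v w : bil A (u + v) w = bil A u w + bil A v w.
Proof. by rewrite /bil !mulmxDl mxE. Qed.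

Lemma bil_tr A v w : bil A^T v w = bil A w v.
Proof.
rewrite !bilE exchange_big /=; apply: eq_bigr => i _; apply: eq_bigr => j _.
by rewrite mxE; ring.
Qed.

Lemma bil_inj A (u v : 'rV[R]_n) : A \in unitmx ->
  (forall w, bil A u w = bil A v w) -> u = v.
Proof.
move=> uA uv; apply: (can_inj (mulmxK uA)); apply/rowP => j.
have := uv (delta_mx 0 j); rewrite /bil trmx_delta -!colE.
by rewrite [LHS]mxE [RHS]mxE.
Qed.

End Bilinear.

Section MatrixDerivative.
Variables (R : realType) (n : nat).
Implicit Types (V : set 'rV[R]_n).

Lemma smooth_mx_derivable V k l (A : 'rV[R]_n -> 'M[R]_(k, l)) y v :
  smooth_mx V A -> V y -> derivable A y v.
Proof.
move=> sA Vy; apply/derivable_mxP => i j; apply: diff_derivable.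
exact: smooth_on_differentiable (sA i j) Vy.
Qed.

Lemma derivable_mulmx k l m (A : 'rV[R]_n -> 'M[R]_(k, l))
    (B : 'rV[R]_n -> 'M[R]_(l, m)) y v :
  derivable A y v -> derivable B y v -> derivable (fun z => A z *m B z) y v.
Proof.
move=> /derivable_mxP dA /derivable_mxP dB; apply/derivable_mxP => i j.
rewrite (_ : (fun _ => _) = \sum_a ((fun z => A z i a) * (fun z => B z a j))).
  by apply: derivable_sum => a; apply: derivableM.
by apply/funext => z; rewrite mxE fct_sumE.
Qed.

Lemma derive_mulmx k l m (A : 'rV[R]_n -> 'M[R]_(k, l))
    (B : 'rV[R]_n -> 'M[R]_(l, m)) y v :
  derivable A y v -> derivable B y v ->
  'D_v (fun z => A z *m B z) y = 'D_v A y *m B y + A y *m 'D_v B y.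
Proof.
move=> dA dB; have dAB := derivable_mulmx dA dB.
have eA := derivable_mxP A y v; have {}eA := eA.1 dA.
have eB := derivable_mxP B y v; have {}eB := eB.1 dB.
apply/matrixP => i j; rewrite -derive_entry //.
rewrite (_ : (fun _ => _) = \sum_a ((fun z => A z i a) * (fun z => B z a j))).
  rewrite derive_sum; last by move=> a; apply: derivableM.
  rewrite !mxE -big_split /=; apply: eq_bigr => a _.
  transitivity (A y i a * 'D_v (fun z => B z a j) y
                + B y a j * 'D_v (fun z => A z i a) y); first by rewrite -deriveM.
  rewrite (derive_entry i a dA) (derive_entry a j dB) addrC.
  by congr (_ + _); exact: mulrC.
by apply/funext => z; rewrite mxE fct_sumE.
Qed.

Lemma derivable_trmx k l (A : 'rV[R]_n -> 'M[R]_(k, l)) y v :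
  derivable A y v -> derivable (fun z => (A z)^T) y v.
Proof.
move=> /derivable_mxP dA; apply/derivable_mxP => i j.
by under eq_fun do rewrite mxE; exact: dA.
Qed.

Lemma derive_trmx k l (A : 'rV[R]_n -> 'M[R]_(k, l)) y v :
  derivable A y v -> 'D_v (fun z => (A z)^T) y = ('D_v A y)^T.
Proof.
move=> dA; have dAt := derivable_trmx dA.
apply/matrixP => i j; rewrite -derive_entry // [RHS]mxE -derive_entry //.
by congr ('D_v _ y); apply/funext => z; rewrite mxE.
Qed.

Lemma derive_bil (A : 'rV[R]_n -> 'M[R]_n) (X Y : 'rV[R]_n -> 'rV[R]_n) y v :
  derivable A y v -> derivable X y v -> derivable Y y v ->
  'D_v (fun z => bil (A z) (X z) (Y z)) y =
  bil ('D_v A y) (X y) (Y y) + bil (A y) ('D_v X y) (Y y)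
  + bil (A y) (X y) ('D_v Y y).
Proof.
move=> dA dX dY; have dXA := derivable_mulmx dX dA.
have dYt := derivable_trmx dY.
have dXAY := derivable_mulmx dXA dYt.
rewrite /bil derive_entry // derive_mulmx // derive_mulmx // derive_trmx //.
by rewrite mulmxDl !mxE (addrC (\sum_j ('D_v X y *m _) _ _ * _)).
Qed.

Lemma smooth_on_mx V k l (A : 'rV[R]_n -> 'M[R]_(k, l)) : open V ->
  smooth_on V A -> smooth_mx V A.
Proof. by move=> oV sA i j; exact: smooth_on_entry. Qed.

Lemma smooth_mx_dir V k l (A : 'rV[R]_n -> 'M[R]_(k, l)) v : open V ->
  smooth_mx V A -> smooth_mx V (fun y => 'D_v A y).
Proof.
move=> oV sA i j; apply: smooth_on_local => y Vy.
exists V, (fun z => 'D_v (fun x => A x i j) z); split => //.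
  exact: smooth_on_dir.
apply: (open_near_eq oV Vy) => z Vz; rewrite derive_entry //.
exact: smooth_mx_derivable sA Vz.
Qed.

Lemma smooth_mx_dir_derivable V k l (A : 'rV[R]_n -> 'M[R]_(k, l)) y v w :
  open V -> smooth_mx V A -> V y -> derivable (fun z => 'D_w A z) y v.
Proof.
move=> oV sA Vy; have sD := smooth_mx_dir w oV sA.
apply/derivable_mxP => i j; apply: diff_derivable.
exact: smooth_on_differentiable (sD i j) Vy.
Qed.

Lemma smooth_mx_schwarz V k l (A : 'rV[R]_n -> 'M[R]_(k, l)) y v w : open V ->
  V y -> smooth_mx V A ->
  'D_v (fun z => 'D_w A z) y = 'D_w (fun z => 'D_v A z) y.
Proof.
move=> oV Vy sA; apply/matrixP => i j.
have e v' w' : 'D_v' (fun z => 'D_w' A z) y i j =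
    'D_v' (fun z => 'D_w' (fun x => A x i j) z) y.
  rewrite -derive_entry; last first.
    exact: smooth_mx_derivable (smooth_mx_dir w' oV sA) Vy.
  apply: near_eq_derive; apply: (open_near_eq oV Vy) => z Vz.
  by rewrite derive_entry //; exact: smooth_mx_derivable sA Vz.
transitivity ('D_v (fun z => 'D_w (fun x => A x i j) z) y); first exact: e.
transitivity ('D_w (fun z => 'D_v (fun x => A x i j) z) y); last exact/esym/e.
exact: smooth_on_schwarz oV Vy (sA i j).
Qed.

End MatrixDerivative.

Section Hessian.
Variables (R : realType) (n : nat).

(** The Christoffel symbols of the first kind, as a trilinear form: the
    coordinate-free form makes the change of charts a chain rule. *)
Definition christoffel1 (g : 'rV[R]_n -> 'M[R]_n) y (v w u : 'rV[R]_n) : R :=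
  2^-1 * (bil ('D_v g y) w u + bil ('D_w g y) v u - bil ('D_u g y) v w).

Definition hess (g : 'rV[R]_n -> 'M[R]_n) (f : 'rV[R]_n -> R) y v w : R :=
  'D_v (fun z => 'D_w f z) y - christoffel1 g y v w (grad g f y).

Record metric_on (V : set 'rV[R]_n) (g : 'rV[R]_n -> 'M[R]_n) : Prop := {
  metric_on_open : open V;
  metric_on_smooth : smooth_on V g;
  metric_on_sym : forall y, V y -> (g y)^T = g y;
  metric_on_unit : forall y, V y -> g y \in unitmx }.

Section Chart.
Variables (V : set 'rV[R]_n) (g : 'rV[R]_n -> 'M[R]_n).
Hypothesis gV : metric_on V g.
Let oV := metric_on_open gV.
Let sg := metric_on_smooth gV.
Let symg := metric_on_sym gV.
Let unitg := metric_on_unit gV.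
Let smg : smooth_mx V g := smooth_on_mx oV sg.

Lemma metric_deriv_sym y v : V y -> ('D_v g y)^T = 'D_v g y.
Proof.
move=> Vy; rewrite -derive_trmx; last exact: smooth_mx_derivable smg Vy.
by apply: near_eq_derive; exact: (open_near_eq oV Vy).
Qed.

Lemma bil_deriv_sum y (v w u : 'rV[R]_n) : V y ->
  bil ('D_v g y) w u =
  \sum_i \sum_j \sum_l v 0 i * w 0 j * u 0 l * 'D_(e_ R i) (fun z => g z j l) y.
Proof.
move=> Vy; rewrite bilE.
have E j l : 'D_v g y j l = \sum_i v 0 i * 'D_(e_ R i) (fun z => g z j l) y.
  rewrite -derive_entry; last exact: smooth_mx_derivable smg Vy.
  by rewrite derive_dir //; exact: smooth_on_differentiable (smg _ _) Vy.
under eq_bigr do under eq_bigr do rewrite E mulr_sumr mulr_suml.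
under eq_bigr do rewrite exchange_big.
rewrite exchange_big; apply: eq_bigr => i _; apply: eq_bigr => j _.
by apply: eq_bigr => l _; ring.
Qed.

Lemma covd_entry (Y : 'rV[R]_n -> 'rV[R]_n) y v k : derivable Y y v ->
  covd g Y y v 0 k = 'D_v (fun z => Y z 0 k) y
    + \sum_i \sum_j christoffel g y i j k * v 0 i * Y y 0 j.
Proof.
by move=> dY; rewrite /covd mxE derive_entry //; congr (_ + _); rewrite mxE.
Qed.

(** Lowering the index of the covariant derivative cancels the inverse metric
    in the Christoffel symbols. *)
Lemma covd_pairing (Y : 'rV[R]_n -> 'rV[R]_n) y v w : V y ->
  bil (g y) (covd g Y y v) w =
  bil (g y) ('D_v Y y) w + christoffel1 g y v (Y y) w.
Proof.
move=> Vy; rewrite /covd bilDl; congr (_ + _).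
pose T i j l : R := 2^-1 * ('D_(e_ R i) (fun z => g z j l) y
  + 'D_(e_ R j) (fun z => g z i l) y - 'D_(e_ R l) (fun z => g z i j) y).
have -> : (\row_k \sum_i \sum_j christoffel g y i j k * v 0 i * Y y 0 j)
  = (\row_l \sum_i \sum_j T i j l * v 0 i * Y y 0 j) *m invmx (g y).
  apply/rowP => k; rewrite !mxE.
  under [RHS]eq_bigr do rewrite mxE mulr_suml.
  rewrite [RHS]exchange_big; apply: eq_bigr => i _ /=.
  under [RHS]eq_bigr do rewrite mulr_suml.
  rewrite [RHS]exchange_big; apply: eq_bigr => j _ /=.
  rewrite /christoffel mulr_sumr !mulr_suml; apply: eq_bigr => l _.
  have -> : invmx (g y) k l = invmx (g y) l k.
    by rewrite -[in LHS](symg Vy) -trmx_inv mxE.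
  rewrite /T; ring.
rewrite /bil mulmxKV ?unitg // mxE.
rewrite /christoffel1 !(bil_deriv_sum _ _ _ Vy).
under eq_bigr do rewrite !mxE mulr_suml.
under eq_bigr do under eq_bigr do rewrite mulr_suml.
rewrite exchange_big /=; under eq_bigr do rewrite exchange_big /=.
rewrite [X in _ = _ * (_ + X - _)]exchange_big /=.
rewrite [X in _ = _ * (_ - X)]exchange_big /=.
under [X in _ = _ * (_ - X)]eq_bigr do rewrite exchange_big /=.
rewrite -big_split -sumrB mulr_sumr; apply: eq_bigr => i _.
rewrite -big_split -sumrB mulr_sumr; apply: eq_bigr => j _.
rewrite -big_split -sumrB mulr_sumr; apply: eq_bigr => l _.
rewrite /T /=; ring.
Qed.

Section Function.
Variable f : 'rV[R]_n -> R.
Hypothesis sf : smooth_on V f.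

Lemma grad_smooth : smooth_mx V (grad g f).
Proof.
apply: smooth_mxM => // [i j|]; last exact: smooth_mx_inv.
by under eq_fun do rewrite mxE; exact: smooth_on_partial.
Qed.

Lemma grad_pairing y w : V y -> bil (g y) (grad g f y) w = 'D_w f y.
Proof.
move=> Vy; rewrite /bil /grad mulmxKV ?unitg // mxE derive_dir; last first.
  exact: smooth_on_differentiable sf Vy.
by apply: eq_bigr => j _; rewrite !mxE mulrC.
Qed.

(** Differentiate the identity g(grad f, w) = D_w f along v. *)
Lemma hess_pairing y v w : V y ->
  bil (g y) (covd g (grad g f) y v) w = hess g f y v w.
Proof.
move=> Vy; rewrite covd_pairing //.
have dg := smooth_mx_derivable (v := v) smg Vy.
have dY := smooth_mx_derivable (v := v) grad_smooth Vy.
have : 'D_v (fun z => bil (g z) (grad g f z) w) y = 'D_v (fun z => 'D_w f z) y.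
  by apply: near_eq_derive; apply: (open_near_eq oV Vy) => z; exact: grad_pairing.
rewrite (derive_bil dg dY (derivable_cst _ _ _)) derive_cst.
have -> : bil (g y) (grad g f y) 0 = 0 by rewrite /bil trmx0 mulmx0 mxE.
rewrite /hess => <-; rewrite /christoffel1.
have S w' a b : bil ('D_w' g y) a b = bil ('D_w' g y) b a.
  by rewrite -bil_tr metric_deriv_sym.
have half_sum (a b c d : R) :
  a + 2^-1 * (b + c - d) = b + a + 0 - 2^-1 * (b + d - c) by lra.
rewrite (S v w (grad g f y)); exact: half_sum.
Qed.

(** The endomorphism v |-> nabla_v (grad f), acting on row vectors. *)
Definition hess_mx y : 'M[R]_n :=
  \matrix_(i, k) covd g (grad g f) y (e_ R i) 0 k.

Lemma covd_gradE y v : V y -> covd g (grad g f) y v = v *m hess_mx y.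
Proof.
move=> Vy; apply/rowP => k.
have dY w := smooth_mx_derivable (v := w) grad_smooth Vy.
rewrite covd_entry // [RHS]mxE derive_dir; last first.
  exact: smooth_on_differentiable (grad_smooth _ _) Vy.
rewrite -big_split /=; apply: eq_bigr => i _.
rewrite [hess_mx _ _ _]mxE covd_entry // mulrDr; congr (_ + _).
rewrite [in RHS](bigD1 i) //= [X in _ = _ * (_ + X)]big1 ?addr0; last first.
  move=> i' /negbTE ii'; rewrite big1 // => j _.
  by rewrite mxE eqxx ii' /= mulr0 mul0r.
rewrite mulr_sumr; apply: eq_bigr => j _.
by rewrite /e_ [delta_mx _ _ _ _]mxE !eqxx /= mulr1 mulrCA mulrA.
Qed.

Lemma hess_mx_smooth : smooth_mx V hess_mx.
Proof.
move=> i k; under eq_fun do rewrite !mxE.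
apply: smooth_onD => //; first exact: smooth_mx_dir grad_smooth _ _.
apply: smooth_on_sum => // a _; apply: smooth_on_sum => // j _.
apply: smooth_onM => //; last exact: grad_smooth.
apply: smooth_onM => //; last exact: smooth_on_cstr.
rewrite /christoffel; apply: smooth_onM => //; first exact: smooth_on_cstr.
apply: smooth_on_sum => // l _; apply: smooth_onM => //.
  exact: smooth_mx_inv.
apply: smooth_onD => //.
  by apply: smooth_onD => //; exact: smooth_on_partial (smg _ _).
under eq_fun do rewrite -mulN1r.
apply: smooth_onM => //; first exact: smooth_on_cstr.
exact: smooth_on_partial (smg _ _).
Qed.

End Function.

(** The chain rule: grad (theta o f) = theta'(f) grad f, and differentiating
    the factor theta'(f) produces the rank one term df (x) grad f. *)
Lemma hess_mx_comp (th : nat -> R -> R) f y : 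
  (forall k (t : R), is_derive t 1 (th k) (th k.+1 t)) -> smooth_on V f -> V y ->
  hess_mx (fun z => th 0%N (f z)) y =
  th 1%N (f y) *: hess_mx f y
  + th 2%N (f y) *: ((\row_i 'D_(e_ R i) f y)^T *m grad g f y).
Proof.
move=> dth sf Vy.
have sf1 : smooth_on V (fun z => th 1%N (f z)).
  by apply: (@smooth_on_comp _ _ _ oV (fun k => th k.+1)) => // k t; exact: dth.
have gE z : V z -> grad g (fun z => th 0%N (f z)) z = th 1%N (f z) *: grad g f z.
  move=> Vz; rewrite /grad scalemxAl; congr (_ *m _).
  apply/rowP => j; rewrite !mxE; apply: is_derive_comp_real => //.
  exact: smooth_on_differentiable sf Vz.
have dY v := smooth_mx_derivable (v := v) (grad_smooth sf) Vy.
have sthf : smooth_on V (fun z => th 0%N (f z)) by exact: smooth_on_comp.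
have dYth v := smooth_mx_derivable (v := v) (grad_smooth sthf) Vy.
have E k i : 'D_(e_ R i) (fun z => grad g (fun z => th 0%N (f z)) z 0 k) y =
    th 1%N (f y) * 'D_(e_ R i) (fun z => grad g f z 0 k) y
    + th 2%N (f y) * 'D_(e_ R i) f y * grad g f y 0 k.
  rewrite (near_eq_derive (g := (fun z => th 1%N (f z)) * (fun z => grad g f z 0 k)));
    last by apply: (open_near_eq oV Vy) => z Vz; rewrite gE // mxE.
  have df : differentiable f y by exact: smooth_on_differentiable sf Vy.
  rewrite deriveM; last 2 first.
    - by apply: diff_derivable; exact: smooth_on_differentiable sf1 Vy.
    - exact: diff_derivable (smooth_on_differentiable (grad_smooth sf _ _) Vy).
  rewrite (is_derive_comp_real _ (dth 1%N (f y))) //.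
  by congr (_ + _); exact: mulrC.
apply/matrixP => i k; rewrite [LHS]mxE covd_entry // E gE //.
rewrite [RHS]mxE [X in _ = X + _]mxE [X in _ = _ * X + _]mxE covd_entry //.
rewrite [X in _ = _ + X]mxE [X in _ = _ + _ * X]mxE big_ord1.
rewrite (_ : (\row__ _)^T i _ = 'D_(e_ R i) f y); last by rewrite !mxE.
have -> : \sum_(i0 < n) \sum_(j < n) christoffel g y i0 j k * e_ R i 0 i0 *
     (th 1%N (f y) *: grad g f y) 0 j =
   th 1%N (f y) * \sum_(i0 < n) \sum_(j < n) christoffel g y i0 j k *
   e_ R i 0 i0 * grad g f y 0 j.
  rewrite mulr_sumr; apply: eq_bigr => a _.
  rewrite mulr_sumr; apply: eq_bigr => j _.
  by rewrite [(_ *: grad g f y) 0 j]mxE mulrCA.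
by rewrite mulrDr addrAC mulrA.
Qed.

Lemma hess_mxD f h y : smooth_on V f -> smooth_on V h -> V y ->
  hess_mx (fun z => f z + h z) y = hess_mx f y + hess_mx h y.
Proof.
move=> sf sh Vy.
have gE z : V z -> grad g (fun z => f z + h z) z = grad g f z + grad g h z.
  move=> Vz; rewrite /grad -mulmxDl; congr (_ *m _).
  apply/rowP => j; rewrite !mxE; rewrite -[LHS]/('D_(e_ R j) (f + h) z) deriveD //.
    exact: diff_derivable (smooth_on_differentiable sf Vz).
  exact: diff_derivable (smooth_on_differentiable sh Vz).
have df v := smooth_mx_derivable (v := v) (grad_smooth sf) Vy.
have dh v := smooth_mx_derivable (v := v) (grad_smooth sh) Vy.
have dfh v := smooth_mx_derivable (v := v) (grad_smooth (smooth_onD oV sf sh)) Vy.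
apply/matrixP => i k; rewrite [LHS]mxE [RHS]mxE [X in _ = X + _]mxE.
rewrite [X in _ = _ + X]mxE !covd_entry // gE //.
rewrite (near_eq_derive (g := (fun z => grad g f z 0 k) + (fun z => grad g h z 0 k)));
    last by apply: (open_near_eq oV Vy) => z Vz; rewrite gE // mxE.
rewrite deriveD; last 2 first.
  - exact: diff_derivable (smooth_on_differentiable (grad_smooth sf _ _) Vy).
  - exact: diff_derivable (smooth_on_differentiable (grad_smooth sh _ _) Vy).
rewrite addrACA -big_split /=; congr (_ + _); apply: eq_bigr => a _.
rewrite -big_split /=; apply: eq_bigr => j _.
by rewrite [(grad g f y + _) _ _]mxE mulrDr.
Qed.

End Chart.

Lemma hess_mx_near (g : 'rV[R]_n -> 'M[R]_n) (f h : 'rV[R]_n -> R) y :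
  (\forall z \near y, f z = h z) -> hess_mx g f y = hess_mx g h y.
Proof.
move=> fh.
have nY : \forall z \near y, grad g f z = grad g h z.
  move: fh => /near_join; apply: filterS => z fhz; rewrite /grad.
  by congr (_ *m _); apply/rowP => j; rewrite !mxE; exact: near_eq_derive.
have Ey : grad g f y = grad g h y by exact: nbhs_singleton nY.
by apply/matrixP => i k; rewrite [LHS]mxE [RHS]mxE /covd Ey (near_eq_derive _ nY).
Qed.


(** The bookkeeping behind [hess_tau]: p, q, r are the terms in which a second
    derivative of the chart change is paired with a vector; q and r cancel
    inside the Christoffel form, and p against the second derivative of f. *)
Lemma hess_cancel (dd a b c dd' a' b' c' p q r : R) :
  dd = p + dd' -> a = a' + p + q -> b = b' + p + r -> c = c' + q + r ->
  dd - 2^-1 * (a + b - c) = dd' - 2^-1 * (a' + b' - c').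
Proof. move=> -> -> -> ->; lra. Qed.

Section Invariance.
Variables (V V' : set 'rV[R]_n) (g g' : 'rV[R]_n -> 'M[R]_n).
Variables (f f' : 'rV[R]_n -> R) (tau : 'rV[R]_n -> 'rV[R]_n).
Hypotheses (gV : metric_on V g) (gV' : metric_on V' g').
Hypotheses (sf : smooth_on V f) (sf' : smooth_on V' f') (stau : smooth_on V tau).
Hypothesis tauV : forall z, V z -> V' (tau z).
Hypothesis f_tau : forall z, V z -> f z = f' (tau z).
Hypothesis g_tau : forall z, V z ->
  g z = 'J tau z *m g' (tau z) *m ('J tau z)^T.
Let oV := metric_on_open gV.
Let oV' := metric_on_open gV'.
Let smtau : smooth_mx V tau := smooth_on_mx oV stau.
Let smg : smooth_mx V g := smooth_on_mx oV (metric_on_smooth gV).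

Lemma bil_tau z w u : V z ->
  bil (g z) w u = bil (g' (tau z)) ('D_w tau z) ('D_u tau z).
Proof.
move=> Vz; have dt := smooth_on_differentiable stau Vz.
by rewrite /bil g_tau // !deriveEjacobian // trmx_mul !mulmxA.
Qed.

Lemma jacobian_unit z : V z -> 'J tau z \in unitmx.
Proof.
move=> Vz; have := metric_on_unit gV Vz; rewrite g_tau // !unitmx_mul.
by case/andP => /andP[].
Qed.

Lemma derive_f_tau z w : V z -> 'D_w f z = 'D_('D_w tau z) f' (tau z).
Proof.
move=> Vz; rewrite -(derive_comp_diff (f := tau) (g := f')).
- by apply: near_eq_derive; exact: (open_near_eq oV Vz).
- exact: smooth_on_differentiable stau Vz.
- exact: smooth_on_differentiable sf' (tauV Vz).
Qed.

(** The gradient is a vector field: it is determined by its pairings with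
    tangent vectors, which are directional derivatives. *)
Lemma grad_tau z : V z -> grad g f z *m 'J tau z = grad g' f' (tau z).
Proof.
move=> Vz; apply: (bil_inj (metric_on_unit gV' (tauV Vz))) => w.
rewrite (grad_pairing gV' sf' _ (tauV Vz)).
pose u := w *m invmx ('J tau z).
have dt := smooth_on_differentiable stau Vz.
have -> : w = 'D_u tau z.
  by rewrite deriveEjacobian // mulmxKV // jacobian_unit.
rewrite -deriveEjacobian // -bil_tau // -derive_f_tau //.
exact: (grad_pairing gV sf).
Qed.

Variables (y v w : 'rV[R]_n).
Hypothesis Vy : V y.
Let X a b := 'D_a (fun z => 'D_b tau z) y.

Let X_sym a b : X a b = X b a.
Proof. exact: smooth_mx_schwarz oV Vy smtau. Qed.

Let derive_derive_tau :
  'D_v (fun z => 'D_w f z) y = 'D_(X v w) f' (tau y)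
    + 'D_('D_v tau y) (fun z => 'D_('D_w tau y) f' z) (tau y).
Proof.
have dtau := smooth_on_differentiable stau Vy.
have Vty := tauV Vy.
pose df z : 'rV[R]_n := \row_k 'D_(e_ R k) f' (tau z).
have E z : V z -> 'D_w f z = ('D_w tau z *m (df z)^T) 0 0.
  move=> Vz; rewrite derive_f_tau // derive_dir; last first.
    exact: smooth_on_differentiable sf' (tauV Vz).
  by rewrite mxE; apply: eq_bigr => k _; rewrite !mxE.
have sDf k := smooth_on_partial k sf'.
have ddfk k : differentiable (fun z => 'D_(e_ R k) f' (tau z)) y.
  apply: (differentiable_comp (g := fun z => 'D_(e_ R k) f' z)) => //.
  exact: smooth_on_differentiable (sDf k) Vty.
have ddf : derivable df y v.
  apply/derivable_mxP => i k; apply: diff_derivable.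
  by under eq_fun do rewrite mxE; exact: ddfk.
have dX : derivable (fun z => 'D_w tau z) y v.
  exact: smooth_mx_dir_derivable oV smtau Vy.
rewrite (near_eq_derive (g := fun z => ('D_w tau z *m (df z)^T) 0 0));
  last exact: (open_near_eq oV Vy).
have ddft := derivable_trmx ddf.
rewrite derive_entry; last exact: derivable_mulmx.
rewrite derive_mulmx // derive_trmx // mxE; congr (_ + _).
  rewrite [RHS]derive_dir; last exact: smooth_on_differentiable sf' Vty.
  by rewrite mxE; apply: eq_bigr => k _; rewrite !mxE.
rewrite (near_eq_derive
    (g := \sum_k (fun z => 'D_w tau y 0 k * 'D_(e_ R k) f' z))); last first.
  apply: (open_near_eq oV' Vty) => z Vz; rewrite derive_dir.
    by rewrite fct_sumE.
  exact: smooth_on_differentiable sf' Vz.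
rewrite derive_sum; last first.
  move=> k; apply: derivableZ; apply: diff_derivable.
  exact: smooth_on_differentiable (sDf k) Vty.
rewrite mxE; apply: eq_bigr => k _.
rewrite deriveZ; last first.
  by apply: diff_derivable; exact: smooth_on_differentiable (sDf k) Vty.
congr (_ * _).
rewrite mxE -derive_entry //.
under eq_fun do rewrite mxE.
apply: (derive_comp_diff (g := fun z => 'D_(e_ R k) f' z)) => //.
exact: smooth_on_differentiable (sDf k) Vty.
Qed.

Let derive_metric_tau a b c : bil ('D_a g y) b c =
  bil ('D_('D_a tau y) g' (tau y)) ('D_b tau y) ('D_c tau y)
  + bil (g' (tau y)) (X a b) ('D_c tau y)
  + bil (g' (tau y)) ('D_b tau y) (X a c).
Proof.
have dtau := smooth_on_differentiable stau Vy.
have dg := smooth_mx_derivable (v := a) smg Vy.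
have dg'tau : differentiable (g' \o tau) y.
  apply: differentiable_comp => //.
  exact: smooth_on_differentiable (metric_on_smooth gV') (tauV Vy).
have dX d : derivable (fun z => 'D_d tau z) y a.
  exact: smooth_mx_dir_derivable oV smtau Vy.
transitivity ('D_a (fun z => bil (g z) b c) y).
  rewrite (derive_bil dg (derivable_cst _ _ _) (derivable_cst _ _ _)).
  by rewrite !derive_cst /bil trmx0 !mulmx0 !mul0mx !mxE !addr0.
rewrite (near_eq_derive
  (g := fun z => bil ((g' \o tau) z) ('D_b tau z) ('D_c tau z))); last first.
  by apply: (open_near_eq oV Vy) => z Vz; exact: bil_tau.
rewrite (derive_bil (diff_derivable dg'tau) (dX b) (dX c)).
rewrite derive_comp_diff //.
exact: smooth_on_differentiable (metric_on_smooth gV') (tauV Vy).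
Qed.

(** Tensoriality of the Hessian.  The second derivatives X(a, b) of the chart
    change appear both in D_v D_w f and in the Christoffel form, and they are
    symmetric in a and b. *)
Lemma hess_tau :
  hess g f y v w = hess g' f' (tau y) ('D_v tau y) ('D_w tau y).
Proof.
have dtau := smooth_on_differentiable stau Vy.
set Y := grad g f y; set U := grad g' f' (tau y).
have YU : 'D_Y tau y = U by rewrite deriveEjacobian // grad_tau.
have S a b : bil (g' (tau y)) a b = bil (g' (tau y)) b a.
  by rewrite -bil_tr (metric_on_sym gV' (tauV Vy)).
have E1 := derive_metric_tau v w Y.
have E2 := derive_metric_tau w v Y.
have E3 := derive_metric_tau Y v w.
rewrite YU in E1 E2 E3.
rewrite (X_sym w v) in E2.
rewrite (X_sym Y v) (X_sym Y w) (S (X v Y)) in E3.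
have E4 := derive_derive_tau.
rewrite -(grad_pairing gV' sf' (X v w) (tauV Vy)) -/U in E4.
rewrite (S U) in E4; exact: hess_cancel E4 E1 E2 E3.
Qed.

End Invariance.

(** Tensoriality for the endomorphism follows from the one for the bilinear
    form, since the metric is nondegenerate. *)
Lemma hess_mx_tau (V V' : set 'rV[R]_n) (g g' : 'rV[R]_n -> 'M[R]_n)
    (f f' : 'rV[R]_n -> R) (tau : 'rV[R]_n -> 'rV[R]_n) y :
  metric_on V g -> metric_on V' g' ->
  smooth_on V f -> smooth_on V' f' -> smooth_on V tau ->
  (forall z, V z -> V' (tau z)) -> (forall z, V z -> f z = f' (tau z)) ->
  (forall z, V z -> g z = 'J tau z *m g' (tau z) *m ('J tau z)^T) ->
  V y -> hess_mx g f y *m 'J tau y = 'J tau y *m hess_mx g' f' (tau y).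
Proof.
move=> gV gV' sf sf' stau tauV f_tau g_tau Vy.
have dtau := smooth_on_differentiable stau Vy.
have uJ := jacobian_unit gV g_tau Vy.
apply/row_matrixP => i; rewrite !row_mul !rowE.
rewrite -(covd_gradE gV sf _ Vy) -!(deriveEjacobian (f := tau)) //.
rewrite -(covd_gradE gV' sf' _ (tauV _ Vy)).
apply: (bil_inj (metric_on_unit gV' (tauV _ Vy))) => w.
rewrite (hess_pairing gV' sf' _ _ (tauV _ Vy)).
pose u := w *m invmx ('J tau y).
have -> : w = 'D_u tau y by rewrite deriveEjacobian // mulmxKV.
rewrite -(hess_tau gV gV' sf sf' stau tauV f_tau g_tau) //.
rewrite -(bil_tau stau g_tau) //.
by rewrite (hess_pairing gV sf).
Qed.

End Hessian.

(** * Alternating forms, orthonormal frames and the first cousin principle *)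

Section AlternatingForms.
Variables (R : realType) (n p : nat).
Implicit Types (v : 'M[R]_(p, n)) (u : 'rV[R]_n) (w : 'M[R]_(p, n) -> R).

Lemma row_set_row v i u : row i (set_row v i u) = u.
Proof. by apply/rowP => j; rewrite !mxE eqxx. Qed.

Lemma row_set_row_neq v i k u : k != i -> row k (set_row v i u) = row k v.
Proof. by move=> /negbTE ki; apply/rowP => j; rewrite !mxE ki. Qed.

Lemma set_row_row v i : set_row v i (row i v) = v.
Proof. by apply/matrixP => k j; rewrite !mxE; case: eqP => // ->. Qed.

Lemma set_row_set_row v i u u' : set_row (set_row v i u) i u' = set_row v i u'.
Proof. by apply/matrixP => k j; rewrite !mxE; case: eqP. Qed.

Lemma set_rowC v i k u u' : i != k ->
  set_row (set_row v i u) k u' = set_row (set_row v k u') i u.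
Proof.
move=> /negbTE ik; apply/matrixP => a j; rewrite !mxE.
by case: eqP => [->|//]; rewrite eq_sym ik.
Qed.

Section OneForm.
Variable w : 'M[R]_(p, n) -> R.
Hypothesis alt_w : is_alternating w.
Let lin_w := alt_w.1.

Lemma alt0 v i : w (set_row v i 0) = 0.
Proof.
have := lin_w v i (-1) 0 0; rewrite scaler0 addr0 mulN1r => ->.
by rewrite addNr.
Qed.

Lemma altZ v i a u : w (set_row v i (a *: u)) = a * w (set_row v i u).
Proof. by have := lin_w v i a u 0; rewrite addr0 alt0 addr0. Qed.

Lemma altD v i u u' :
  w (set_row v i (u + u')) = w (set_row v i u) + w (set_row v i u').
Proof. by have := lin_w v i 1 u u'; rewrite scale1r mul1r. Qed.

Lemma alt_sum (I : Type) (r : seq I) (P : pred I) v i (c : I -> R)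
    (u : I -> 'rV[R]_n) :
  w (set_row v i (\sum_(k <- r | P k) c k *: u k)) =
  \sum_(k <- r | P k) c k * w (set_row v i (u k)).
Proof.
elim: r => [|k r IH]; first by rewrite !big_nil alt0.
by rewrite !big_cons; case: ifP => // _; rewrite altD altZ IH.
Qed.

Lemma alt_row_eq v i k : k != i -> w (set_row v i (row k v)) = 0.
Proof.
move=> ki; apply: (alt_w.2 _ k i ki).
by rewrite row_set_row row_set_row_neq.
Qed.

(** Polarization of the vanishing on repeated rows. *)
Lemma alt_swap v i k u u' : i != k ->
  w (set_row (set_row v i u) k u') + w (set_row (set_row v i u') k u) = 0.
Proof.
move=> ik.
have alt_eq x : w (set_row (set_row v i x) k x) = 0.
  by apply: (alt_w.2 _ i k ik); rewrite row_set_row row_set_row_neq // row_set_row.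
have := alt_eq (u + u'); rewrite altD ![set_row (set_row v i _) k _]set_rowC //.
by rewrite !altD -!(set_rowC _ _ _ ik) !alt_eq add0r addr0 addrC.
Qed.

(** Replace the rows of A v by those of v from the first one on: the row
    replaced at step k is A k k times row k of v plus a combination of the rows
    already replaced, which an alternating form does not see. *)
Lemma alt_trig (A : 'M[R]_p) v : is_trig_mx A ->
  w (A *m v) = (\prod_i A i i) * w v.
Proof.
move=> /is_trig_mxP trA.
pose V k : 'M[R]_(p, n) := \matrix_(i, j) (if (i < k)%N then v else A *m v) i j.
have step (k : 'I_p) : w (V k) = A k k * w (V k.+1).
  have -> : V k = set_row (V k.+1) k (\sum_j A k j *: row j v).
    apply/matrixP => i j; rewrite !mxE ltnS; case: eqP => [->|/eqP ik].
      rewrite ltnn mxE summxE; apply: eq_bigr => l _; by rewrite !mxE.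
    by rewrite [(i <= k)%N]leq_eqVlt -[(i == k :> nat)]/(i == k) (negbTE ik).
  have VS : set_row (V k.+1) k (row k v) = V k.+1.
    apply/matrixP => i j; rewrite !mxE; case: eqP => // ->.
    by rewrite ltnSn.
  rewrite alt_sum (bigD1 k) //= VS big1 ?addr0 // => j jk.
  have [jltk|kltj] := ltnP j k; last first.
    by rewrite trA ?mul0r // ltn_neqAle kltj andbT eq_sym.
  have -> : row j v = row j (V k.+1).
    by apply/rowP => l; rewrite !mxE ltnS ltnW.
  by rewrite alt_row_eq ?mulr0.
have V0 : V 0%N = A *m v by apply/matrixP => i j; rewrite mxE.
have Vp : V p = v by apply/matrixP => i j; rewrite mxE ltn_ord.
rewrite -V0 -[in RHS]Vp.
have : forall k, (k <= p)%N ->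
    w (V 0%N) = (\prod_(i < p | (i < k)%N) A i i) * w (V k).
  elim=> [|k IH] kp; first by rewrite big_pred0 ?mul1r.
  rewrite IH ?(ltnW kp) // (step (Ordinal kp)) mulrA; congr (_ * _).
  rewrite [RHS](bigD1 (Ordinal kp)) //= mulrC; congr (_ * _).
  by apply: eq_bigl => i; rewrite ltnS -val_eqE /= andbC ltn_neqAle.
move=> /(_ p (leqnn p)) ->; congr (_ * _); apply: eq_bigl => i.
by rewrite ltn_ord.
Qed.

End OneForm.

(** The derivation of alternating forms induced by the endomorphism C; with C
    the Hessian endomorphism of f it is the phi-Hessian. *)
Definition derivation_form w (C : 'M[R]_n) v : R :=
  \sum_i w (set_row v i (row i v *m C)).

Lemma derivation_formD w C C' v : is_alternating w ->
  derivation_form w (C + C') v = derivation_form w C v + derivation_form w C' v.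
Proof.
move=> aw; rewrite -big_split; apply: eq_bigr => i _.
by rewrite mulmxDr altD.
Qed.

Lemma derivation_formZ w c C v : is_alternating w ->
  derivation_form w (c *: C) v = c * derivation_form w C v.
Proof.
move=> aw; rewrite mulr_sumr; apply: eq_bigr => i _.
by rewrite -scalemxAr altZ.
Qed.

(** When rows i and j agree, the terms of index i and j are opposite by
    [alt_swap], and in all the others the repeated rows survive. *)
Lemma derivation_form_alternating w C : is_alternating w ->
  is_alternating (derivation_form w C).
Proof.
move=> aw; split.
  move=> v k a u u'; rewrite /derivation_form mulr_sumr -big_split /=.
  apply: eq_bigr => i _; have [->|ik] := eqVneq i k.
    by rewrite !set_row_set_row !row_set_row mulmxDl -scalemxAl aw.1.
  rewrite !row_set_row_neq // ![set_row (set_row v k _) _ _]set_rowC 1?eq_sym //.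
  by rewrite aw.1.
move=> v i j ij vij; rewrite /derivation_form (bigD1 i) //= (bigD1 j) 1?eq_sym //=.
rewrite big1 ?addr0; last first.
  move=> k /andP[ki kj]; apply: (aw.2 _ i j ij).
  by rewrite !row_set_row_neq // eq_sym.
have := alt_swap aw v (row i v) (row i v *m C) ij.
by rewrite set_row_row -vij addrC vij set_rowC // set_row_row.
Qed.

End AlternatingForms.

Section Cholesky.
Variable R : realType.

Definition posdef n (G : 'M[R]_n) : Prop :=
  forall u : 'rV[R]_n, u != 0 -> 0 < (u *m G *m u^T) 0 0.

Lemma posdef_unit n (G : 'M[R]_n) : posdef G -> G \in unitmx.
Proof.
move=> pG; rewrite -row_free_unit -kermx_eq0; apply/eqP/row_matrixP => i.
rewrite row0; apply/eqP/negP => /negP nz; have := pG _ nz.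
have /sub_kermxP -> : (row i (kermx G) <= kermx G)%MS by exact: row_sub.
by rewrite mul0mx mxE ltxx.
Qed.

(** Induction on the size through the Schur complement of the first entry. *)
Lemma cholesky n (G : 'M[R]_n) : G^T = G -> posdef G ->
  exists A : 'M[R]_n, [/\ is_trig_mx A, forall i, 0 < A i i
     & A *m G *m A^T = 1%:M].
Proof.
elim: n => [|n IH] in G *.
  move=> _ _; exists 1%:M; split; [exact: scalar_mx_is_trig|by case|].
  by apply/matrixP => -[].
move: G; rewrite -[n.+1]/(1 + n)%N => G sG pG.
pose a : R := ulsubmx G 0 0; pose b : 'rV[R]_n := ursubmx G.
pose C : 'M[R]_n := drsubmx G.
have GE : G = block_mx a%:M b b^T C.
  rewrite -[LHS]submxK /b trmx_ursub sG; congr block_mx.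
  exact: mx11_scalar.
have a0 : 0 < a.
  have := pG (row_mx (1%:M : 'M[R]_1) 0); rewrite GE.
  rewrite tr_row_mx mul_row_block mul_row_col !mul0mx !addr0 mul1mx tr_scalar_mx.
  rewrite trmx0 mulmx0 addr0 mulmx1 mxE eqxx mulr1n; apply.
  apply/eqP => /(congr1 lsubmx); rewrite row_mxKl linear0 => /matrixP /(_ 0 0).
  by rewrite !mxE eqxx => /eqP; rewrite oner_eq0.
have an0 : a != 0 by rewrite gt_eqF.
pose S := C - a^-1 *: (b^T *m b).
have sS : S^T = S.
  rewrite /S linearB linearZ /= trmx_mul trmxK; congr (_ - _).
  by rewrite /C trmx_drsub sG.
have pS : posdef S.
  move=> u u0.
  pose t : 'rV[R]_1 := - a^-1 *: (u *m b^T).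
  have := pG (row_mx t u); rewrite GE.
  rewrite tr_row_mx mul_row_block mul_row_col.
  rewrite mul_mx_scalar.
  have -> : a *: t + u *m b^T = 0.
    by rewrite /t scalerA mulrN divff // scaleN1r addNr.
  rewrite mul0mx add0r.
  have -> : t *m b + u *m C = u *m S.
    rewrite /S /t mulmxBr -scalemxAr -scalemxAl scaleNr mulmxA addrC.
    by [].
  apply; apply: contra u0 => /eqP tu.
  by have := congr1 rsubmx tu; rewrite row_mxKr linear0 => ->.
have [A [trA dA AA]] := IH S sS pS.
pose al := (Num.sqrt a)^-1.
have al0 : 0 < al by rewrite invr_gt0 sqrtr_gt0.
have al2 : al * a * al = 1.
  by rewrite /al -{2}(sqr_sqrtr (ltW a0)) expr2; field; rewrite gt_eqF // sqrtr_gt0.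
exists (block_mx al%:M 0 (- a^-1 *: (A *m b^T)) A); split.
- by rewrite is_trig_block_mx // eqxx trA andbT scalar_mx_is_trig.
- move=> i; case: (split_ordP i) => j ->; last by rewrite block_mxEdr.
  by rewrite block_mxEul ord1 mxE eqxx mulr1n.
rewrite GE tr_block_mx !mulmx_block trmx0.
rewrite !mul0mx !addr0 !mulmx0 !addr0 tr_scalar_mx -scalar_mxM.
rewrite (mul_scalar_mx al b).
have z : (- a^-1 *: (A *m b^T)) *m a%:M + A *m b^T = 0.
  by rewrite mul_mx_scalar scalerA mulrN divff // scaleN1r addNr.
rewrite z !mul0mx !add0r.
have -> : (- a^-1 *: (A *m b^T)) *m b + A *m C = A *m S.
  by rewrite /S mulmxBr -scalemxAr -scalemxAl scaleNr mulmxA addrC.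
rewrite AA -scalar_mxM al2.
have -> : (al * a)%:M *m (- a^-1 *: (A *m b^T))^T + (al *: b) *m A^T = 0.
  rewrite linearZ /= trmx_mul trmxK mul_scalar_mx scalerA -scalemxAl.
  by rewrite mulrN mulfK // scaleNr addNr.
by rewrite -scalar_mx_block.
Qed.

End Cholesky.

Section Comass.
Variables (R : realType) (n p : nat).
Variables (g : 'M[R]_n) (w : 'M[R]_(p, n) -> R).
Hypotheses (sg : g^T = g) (pg : posdef g) (alt_w : is_alternating w).
Implicit Types (v : 'M[R]_(p, n)) (u Y N : 'rV[R]_n).

Let gm v : 'M[R]_p := v *m g *m v^T.

Lemma gram_mul (B : 'M[R]_p) v : gm (B *m v) = B *m gm v *m B^T.
Proof. by rewrite /gm trmx_mul !mulmxA. Qed.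

Lemma gram_sym v : (gm v)^T = gm v.
Proof. by rewrite /gm !trmx_mul trmxK sg mulmxA. Qed.

Lemma gram_posdef v : \det (gm v) = 1 -> posdef (gm v).
Proof.
move=> dv u u0; have ugm : gm v \in unitmx by rewrite unitmxE dv unitr1.
have uv : u *m v != 0.
  apply: contra u0 => /eqP uv; rewrite -(mulmxK ugm u) /gm !mulmxA uv.
  by rewrite !mul0mx.
by have := pg uv; rewrite /gm trmx_mul !mulmxA.
Qed.

(** The Cholesky factor of the inverse Gram matrix is triangular with positive
    diagonal, and its determinant squared is 1, so it has determinant 1. *)
Lemma orthonormalize v : \det (gm v) = 1 ->
  exists o : 'M[R]_(p, n), gm o = 1%:M /\
    forall w' : 'M[R]_(p, n) -> R, is_alternating w' -> w' o = w' v.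
Proof.
move=> dv; have [A [trA dA AA]] := cholesky (gram_sym v) (gram_posdef dv).
have dA0 : 0 < \det A by rewrite det_trig // prodr_gt0.
have dA1 : \det A = 1.
  have := congr1 determinant AA; rewrite !det_mulmx dv det_tr det1 mulr1.
  move=> dA2; apply/eqP; rewrite -(@eqrXn2 _ 2) ?ler01 ?(ltW dA0) //.
  by rewrite expr2 dA2 expr1n.
exists (A *m v); split; first by rewrite gram_mul.
by move=> w' aw'; rewrite alt_trig // -det_trig // dA1 mul1r.
Qed.

Lemma quad_sub (u e : 'rV[R]_n) (c : R) :
  ((u - c *: e) *m g *m (u - c *: e)^T) 0 0 = (u *m g *m u^T) 0 0
  - c * (u *m g *m e^T) 0 0 - c * (e *m g *m u^T) 0 0
  + c ^+ 2 * (e *m g *m e^T) 0 0.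
Proof.
have -> : (u - c *: e)^T = u^T - c *: e^T by apply/matrixP => i j; rewrite !mxE.
rewrite mulmxBr !mulmxBl -!scalemxAr -!scalemxAl.
move: (u *m g *m u^T) (u *m g *m e^T) (e *m g *m u^T) (e *m g *m e^T).
by move=> A B C D; rewrite !mxE; ring.
Qed.

(** The Cauchy-Schwarz inequality for u and the g-dual of the j-th coordinate.
    It bounds orthonormal tuples in terms of the metric alone. *)
Lemma posdef_coord_bound u j :
  (u 0 j) ^+ 2 <= (u *m g *m u^T) 0 0 * invmx g j j.
Proof.
have ug := posdef_unit pg.
pose e : 'rV[R]_n := delta_mx 0 j *m invmx g.
have e0 : e != 0.
  apply/negP => /eqP e0; have := mulmxKV ug (delta_mx 0 j : 'rV[R]_n).
  rewrite -/e e0 mul0mx => /matrixP /(_ 0 j); rewrite !mxE !eqxx => /esym/eqP.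
  by rewrite oner_eq0.
have eg : e *m g = delta_mx 0 j by rewrite /e mulmxKV.
have ee : (e *m g *m e^T) 0 0 = invmx g j j.
  by rewrite eg -rowE /e trmx_mul trmx_delta trmx_inv sg -colE !mxE.
set d := invmx g j j in ee *.
have d0 : 0 < d by rewrite -ee pg.
pose z := u - (u 0 j / d) *: e.
have zz : 0 <= (z *m g *m z^T) 0 0.
  have [->|/pg/ltW//] := eqVneq z 0; by rewrite !mul0mx mxE.
have ue : (u *m g *m e^T) 0 0 = u 0 j.
  by rewrite -mulmxA -[g *m e^T]trmxK trmx_mul trmxK sg eg trmx_delta -colE mxE.
have eu : (e *m g *m u^T) 0 0 = u 0 j by rewrite eg -rowE !mxE.
have : (z *m g *m z^T) 0 0 = (u *m g *m u^T) 0 0 - u 0 j ^+ 2 / d.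
  have dn0 : d != 0 by rewrite gt_eqF.
  rewrite /z quad_sub ue eu ee; field.
  exact: dn0.
move=> E; move: zz; rewrite E subr_ge0 ler_pdivrMr //.
Qed.

Hypothesis comass_w : forall v, \det (gm v) = 1 -> w v <= 1.
Variable v : 'M[R]_(p, n).
Hypotheses (dv : \det (gm v) = 1) (wv : w v = 1).

(** Adding t N to row i, with N orthogonal to all rows, changes only the (i, i)
    entry of the Gram matrix, by t^2 |N|^2; the determinant is affine in it. *)
Lemma det_gram_perturb i N : N *m g *m v^T = 0 ->
  exists K, forall t,
  \det (gm (set_row v i (row i v + t *: N))) = 1 + t ^+ 2 * K.
Proof.
move=> Nv.
pose E : 'M[R]_p := \matrix_(a, b) (if a == i then (b == i)%:R else gm v a b).
pose q : R := (N *m g *m N^T) 0 0.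
exists (q * \det E) => s.
pose M := gm v + (s ^+ 2 * q) *: delta_mx i i.
have -> : gm (set_row v i (row i v + s *: N)) = M.
  have -> : set_row v i (row i v + s *: N) = v + s *: (delta_mx i 0 *m N).
    apply/matrixP => a b; rewrite !mxE big_ord1 !mxE eqxx andbT.
    by case: eqP => [->|_]; rewrite ?mul1r // mul0r mulr0 addr0.
  have vN : v *m g *m N^T = 0.
    by apply: trmx_inj; rewrite !trmx_mul trmxK sg mulmxA Nv trmx0.
  rewrite /gm; have -> : (v + s *: (delta_mx i 0 *m N))^T =
      v^T + s *: (N^T *m (delta_mx i 0)^T).
    by rewrite -trmx_mul; apply/matrixP => a b; rewrite !mxE.
  rewrite mulmxDr !mulmxDl -!scalemxAr -!scalemxAl.
  have dNv : delta_mx i 0 *m N *m g *m v^T = 0 :> 'M[R]_p.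
    by rewrite -!(mulmxA (delta_mx i 0)) Nv mulmx0.
  rewrite !mulmxA vN dNv mul0mx !scaler0 addr0 add0r.
  rewrite /M; congr (_ + _); rewrite scalerA -expr2 -scalerA; congr (_ *: _).
  rewrite -!(mulmxA (delta_mx i 0)).
  rewrite [N *m g *m N^T]mx11_scalar -/q mul_scalar_mx -scalemxAr trmx_delta.
  by rewrite mul_delta_mx.
rewrite (@determinant_multilinear _ _ M (gm v) E i 1 (s ^+ 2 * q)).
- by rewrite mul1r dv mulrA.
- by apply/rowP => b; rewrite !mxE eqxx mul1r [b == i]eq_sym eq_sym.
- apply/matrixP => a b; rewrite !mxE eq_sym (negbTE (neq_lift _ _)) /=.
  by rewrite mulr0 addr0.
- apply/matrixP => a b; rewrite !mxE eq_sym (negbTE (neq_lift _ _)) /=.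
  by rewrite mulr0 addr0.
Qed.

Lemma det_gram_scale (v' : 'M[R]_(p, n)) i c :
  \det (gm (set_row v' i (c *: row i v'))) = c ^+ 2 * \det (gm v').
Proof.
pose d : 'rV[R]_p := \row_k (if k == i then c else 1).
have -> : set_row v' i (c *: row i v') = diag_mx d *m v'.
  apply/matrixP => a b; rewrite mul_diag_mx !mxE.
  by case: eqP => [->|_] //; rewrite mul1r.
rewrite gram_mul !det_mulmx det_tr det_diag.
rewrite (bigD1 i) //= big1; last by move=> k /negbTE ki; rewrite mxE ki.
by rewrite mxE eqxx mulr1 expr2 -!mulrA [\det _ * _]mulrC.
Qed.

(** The first cousin principle: a linear variation of the value of w would beat
    the second order growth of the volume, against comass 1. *)
Lemma first_cousin i N : N *m g *m v^T = 0 -> w (set_row v i N) = 0.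
Proof.
move=> Nv; apply/eqP/negP => /negP be0.
set be := w (set_row v i N) in be0.
pose N' := be^-1 *: N.
have N'v : N' *m g *m v^T = 0 by rewrite -!scalemxAl Nv scaler0.
have wN' : w (set_row v i N') = 1 by rewrite altZ // mulVf.
have [K dK] := det_gram_perturb i N'v.
(* Any t > 0 with t (K - 1) < 2 and 1 + t^2 K > 0 would do. *)
pose t := (`|K| + 1)^-1.
have K1 : 0 < `|K| + 1 by rewrite ltr_wpDl.
have t0 : 0 < t by rewrite invr_gt0.
have tK : t * (`|K| + 1) = 1 by rewrite /t mulVf // gt_eqF.
have K0 : 0 <= `|K| by [].
have Kle : K <= `|K| by rewrite ler_norm.
have Kge : - `|K| <= K by rewrite lerNl -normrN ler_norm.
have D0 : 0 < 1 + t ^+ 2 * K by nra.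
pose vt := set_row v i (row i v + t *: N').
pose c := (Num.sqrt (1 + t ^+ 2 * K))^-1.
have s0 : 0 < Num.sqrt (1 + t ^+ 2 * K) by rewrite sqrtr_gt0.
have := comass_w (v := set_row vt i (c *: row i vt)).
have c2 : c ^+ 2 * (1 + t ^+ 2 * K) = 1.
  by rewrite exprVn sqr_sqrtr ?ltW // mulVf // gt_eqF.
rewrite det_gram_scale dK c2 => /(_ erefl).
rewrite altZ // set_row_row /vt altD // altZ // set_row_row wN' wv mulr1.
rewrite /c mulrC ler_pdivrMr // mul1r => le1.
have : (1 + t) ^+ 2 <= 1 + t ^+ 2 * K.
  have <- : Num.sqrt (1 + t ^+ 2 * K) ^+ 2 = 1 + t ^+ 2 * K.
    by rewrite sqr_sqrtr // ltW.
  by apply: lerXn2r => //; rewrite nnegrE ?(ltW s0) // addr_ge0 // ltW.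
nra.
Qed.

(** Split Y into a combination c of the rows of v plus a part orthogonal to
    them.  The orthogonal part contributes nothing by [first_cousin], and what
    remains is the squared length of c v. *)
Lemma phi_plane_trace_ge0 Y :
  0 <= \sum_i (Y *m g *m (row i v)^T) 0 0 * w (set_row v i Y).
Proof.
have ugm : gm v \in unitmx by rewrite unitmxE dv unitr1.
pose c := Y *m g *m v^T *m invmx (gm v).
pose N := Y - c *m v.
have Nv : N *m g *m v^T = 0.
  rewrite /N !mulmxBl -!(mulmxA c) -/(gm v).
  by rewrite /c mulmxKV // subrr.
have YE : Y = \sum_k c 0 k *: row k v + N.
  by rewrite -mulmx_sum_row addrC subrK.
have wY i : w (set_row v i Y) = c 0 i.
  rewrite {1}YE altD // (first_cousin i Nv) addr0 alt_sum // (bigD1 i) //=.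
  rewrite set_row_row wv mulr1 big1 ?addr0 // => k ki.
  by rewrite alt_row_eq // mulr0.
have -> : \sum_i (Y *m g *m (row i v)^T) 0 0 * w (set_row v i Y) =
    (c *m gm v *m c^T) 0 0.
  rewrite /c mulmxKV // -/c [RHS]mxE; apply: eq_bigr => i _.
  rewrite wY [c^T _ _]mxE; congr (_ * _).
  by rewrite [LHS]mxE [RHS]mxE; apply: eq_bigr => j _; rewrite !mxE.
have [->|c0] := eqVneq c 0; first by rewrite !mul0mx mxE.
exact: ltW (gram_posdef dv c0).
Qed.

End Comass.

(** * Strict positivity on calibrated planes is an open condition *)

Section LocalStrictness.
Variables (R : realType) (n p : nat).

Lemma cvg_sumr (T I : Type) (F : set_system T) (FF : Filter F) (r : seq I)
    (f : I -> T -> R) (l : I -> R) :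
  (forall i, f i t @[t --> F] --> l i) ->
  (\sum_(i <- r) f i t) @[t --> F] --> \sum_(i <- r) l i.
Proof.
move=> fl; elim: r => [|i r IH].
  rewrite big_nil; under eq_fun do rewrite big_nil; exact: cvg_cst.
rewrite big_cons; under eq_fun do rewrite big_cons.
by apply: cvgD.
Qed.

Lemma cvg_mulmx (T : Type) (F : set_system T) (FF : Filter F) k l m
    (A : T -> 'M[R]_(k, l)) (B : T -> 'M[R]_(l, m))
    (A0 : 'M[R]_(k, l)) (B0 : 'M[R]_(l, m)) :
  (forall i j, A t i j @[t --> F] --> A0 i j) ->
  (forall i j, B t i j @[t --> F] --> B0 i j) ->
  forall i j, (A t *m B t) i j @[t --> F] --> (A0 *m B0) i j.
Proof.
move=> cA cB i j; rewrite mxE; under eq_fun do rewrite mxE.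
by apply: cvg_sumr => a; apply: cvgM.
Qed.

(** Joint continuity in the form and in its arguments.  Induction on the number
    of rows that vary: expanding row k on the standard basis freezes it. *)
Lemma alternating_cvg (T : Type) (F : set_system T) (FF : Filter F)
    (w : T -> 'M[R]_(p, n) -> R) (w0 : 'M[R]_(p, n) -> R)
    (o : T -> 'M[R]_(p, n)) (o0 : 'M[R]_(p, n)) :
  (\forall t \near F, is_alternating (w t)) -> is_alternating w0 ->
  (forall v, w t v @[t --> F] --> w0 v) ->
  (forall i j, o t i j @[t --> F] --> o0 i j) ->
  w t (o t) @[t --> F] --> w0 o0.
Proof.
move=> aw aw0 ww oo.
suff H k : (k <= p)%N -> forall (o : T -> 'M[R]_(p, n)) (o0 : 'M[R]_(p, n)),
    (forall i j, o t i j @[t --> F] --> o0 i j) ->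
    (forall (i : 'I_p) t, (k <= i)%N -> row i (o t) = row i o0) ->
    w t (o t) @[t --> F] --> w0 o0.
  by apply: (H p) => // i t; rewrite leqNgt ltn_ord.
elim: k => [|k IH] kp {oo}o {}o0 oo const.
  have oE t : o t = o0 by apply/row_matrixP => i; exact: const.
  by under eq_fun do rewrite oE; exact: ww.
pose K := Ordinal kp.
have E w' (v : 'M[R]_(p, n)) : is_alternating w' ->
    w' v = \sum_j v K j * w' (set_row v K (delta_mx 0 j)).
  move=> aw'; rewrite -alt_sum //; congr (w' _).
  rewrite -[LHS](set_row_row v K); congr set_row.
  by rewrite [LHS]row_sum_delta; apply: eq_bigr => j _; rewrite mxE.
rewrite (E w0) //.
apply: (@cvg_trans _ ((\sum_j o t K j * w t (set_row (o t) K (delta_mx 0 j)))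
    @[t --> F])).
  by apply: near_eq_cvg; apply: filterS aw => t awt; rewrite -E.
apply: cvg_sumr => j; apply: cvgM; first exact: oo.
apply: (IH (ltnW kp) (fun t => set_row (o t) K (delta_mx 0 j))).
  move=> i l; rewrite mxE; under eq_fun do rewrite mxE.
  by case: eqP => _; [exact: cvg_cst|exact: oo].
move=> i t; rewrite leq_eqVlt => /predU1P[ki|ki].
  have -> : i = K by exact/val_inj.
  by rewrite !row_set_row.
have iK : i != K by rewrite -val_eqE /= gtn_eqF.
by rewrite !row_set_row_neq // const.
Qed.

Variables (V : set 'rV[R]_n) (g : 'rV[R]_n -> 'M[R]_n).
Variables (w : 'rV[R]_n -> 'M[R]_(p, n) -> R) (C : 'rV[R]_n -> 'M[R]_n).
Hypothesis gV : metric_on V g.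
Hypothesis pg : forall y, V y -> posdef (g y).
Hypothesis aw : forall y, V y -> is_alternating (w y).
Hypothesis sw : forall v, smooth_on V (fun y => w y v).
Hypothesis sC : smooth_mx V C.
Let oV := metric_on_open gV.
Let smg : smooth_mx V g := smooth_on_mx oV (metric_on_smooth gV).

Lemma smooth_on_cvg (f : 'rV[R]_n -> R) (T : Type) (F : set_system T)
    (FF : Filter F) (y : T -> 'rV[R]_n) y0 :
  smooth_on V f -> V y0 -> y t @[t --> F] --> y0 ->
  f (y t) @[t --> F] --> f y0.
Proof.
move=> sf Vy0 yy; apply: (cvg_comp _ _ yy).
exact: (differentiable_continuous (smooth_on_differentiable sf Vy0)).
Qed.

(** It suffices to treat orthonormal tuples, which near y0 stay in a fixed
    compact cube; at each tuple of the cube, either positivity, or the failure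
    of one of the two closed conditions, persists nearby. *)
Lemma positive_planes_near y0 : V y0 ->
  (forall v, \det (v *m g y0 *m v^T) = 1 -> w y0 v = 1 ->
     0 < derivation_form (w y0) (C y0) v) ->
  \forall y \near y0, forall v, \det (v *m g y *m v^T) = 1 -> w y v = 1 ->
     0 < derivation_form (w y) (C y) v.
Proof.
move=> Vy0 pos0.
have nV : \forall y \near y0, V y by exact: open_nbhs_nbhs.
have sgi := smooth_mx_inv oV smg (metric_on_unit gV).
(* The cube must contain orthonormal tuples for every y near y0, whence the
   margin 1; it also makes c <= c ^+ 2. *)
pose c := 1 + \sum_j `|invmx (g y0) j j|.
have c1 : 1 <= c by rewrite /c lerDl sumr_ge0.
have bound j : \forall y \near y0, invmx (g y) j j <= c.
  have cv : invmx (g y) j j @[y --> y0] --> invmx (g y0) j j.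
    exact: (differentiable_continuous (smooth_on_differentiable (sgi j j) Vy0)).
  have lt : invmx (g y0) j j < c.
    apply: (le_lt_trans (ler_norm _)); rewrite /c (bigD1 j) //= addrCA.
    by rewrite ltr_pwDr // ltr_pwDl // sumr_ge0.
  by apply: filterS (cvgr_lt _ cv _ lt) => y /ltW.
have {}bound : \forall y \near y0, forall j, invmx (g y) j j <= c.
  exact: (@filter_forall _ _ _ (nbhs y0) _ bound).
pose K : set _ := [set u : 'rV[R]_(p * n) |
  forall i, (`[- c, c]%classic : set R) (u 0 i)].
have cK : compact K.
  by apply: (@rV_compact _ _ (fun=> `[- c, c]%classic)) => i; exact: segment_compact.
pose P (y : 'rV[R]_n) (u : 'rV[R]_(p * n)) :=
  (vec_mx u : 'M[R]_(p, n)) *m g y *m (vec_mx u)^T = 1%:M ->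
  w y (vec_mx u) = 1 -> 0 < derivation_form (w y) (C y) (vec_mx u).
have near_P : \forall y \near y0, K `<=` P y.
  have /compact_near_coveringP NC := cK.
  apply: (NC _ (nbhs y0) P (nbhs_filter y0)) => u0 _.
  pose o0 : 'M[R]_(p, n) := vec_mx u0.
  pose F := filter_prod (nbhs u0) (nbhs y0).
  have FF : Filter F by exact: filter_prod_filter.
  have cy : (fun t : 'rV[R]_(p * n) * 'rV[R]_n => t.2) @ F --> y0 by exact: cvg_snd.
  have cu : (fun t : 'rV[R]_(p * n) * 'rV[R]_n => t.1) @ F --> u0 by exact: cvg_fst.
  have co i j : (vec_mx t.1 : 'M[R]_(p, n)) i j @[t --> F] --> o0 i j.
    rewrite /o0 mxE; under eq_fun do rewrite mxE.
    exact: (cvg_comp _ _ cu (@coord_continuous _ _ _ 0 (mxvec_index i j) u0)).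
  have nVF : \forall t \near F, V t.2 by exact: cy.
  have cw : w t.2 (vec_mx t.1) @[t --> F] --> w y0 o0.
    apply: (@alternating_cvg _ F FF (fun t => w t.2)) => //.
    - by apply: filterS nVF => t; exact: aw.
    - exact: aw.
    - by move=> v; exact: smooth_on_cvg (sw v) Vy0 cy.
  have cgram i j : ((vec_mx t.1 : 'M[R]_(p, n)) *m g t.2 *m (vec_mx t.1)^T) i j
      @[t --> F] --> (o0 *m g y0 *m o0^T) i j.
    apply: cvg_mulmx => [k l|k l].
      apply: cvg_mulmx => // a b; exact: smooth_on_cvg (smg _ _) Vy0 cy.
    by rewrite mxE; under eq_fun do rewrite mxE; exact: co.
  have cH : derivation_form (w t.2) (C t.2) (vec_mx t.1) @[t --> F] -->
      derivation_form (w y0) (C y0) o0.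
    apply: cvg_sumr => i.
    apply: (@alternating_cvg _ F FF (fun t => w t.2)
      (w y0) (fun t => set_row (vec_mx t.1) i (row i (vec_mx t.1) *m C t.2))) => //.
    - by apply: filterS nVF => t; exact: aw.
    - exact: aw.
    - by move=> v; exact: smooth_on_cvg (sw v) Vy0 cy.
    have crow a b : row i (vec_mx t.1 : 'M[R]_(p, n)) a b @[t --> F] --> row i o0 a b.
      by rewrite [row i o0 a b]mxE; under eq_fun do rewrite [row i _ a b]mxE; exact: co.
    have cC a b : C t.2 a b @[t --> F] --> C y0 a b.
      exact: smooth_on_cvg (sC _ _) Vy0 cy.
    move=> k j; rewrite [set_row _ _ _ _ _]mxE.
    under eq_fun do rewrite [set_row _ _ _ _ _]mxE.
    by case: eqP => _; [exact: cvg_mulmx|exact: co].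
  have [H0|H0] := ltP 0 (derivation_form (w y0) (C y0) o0).
    by apply: filterS (cvgr_gt _ cH _ H0) => t Ht _ _.
  have [w1|w1] := eqVneq (w y0 o0) 1; last first.
    have : \forall t \near F, w t.2 (vec_mx t.1) - 1 != 0.
      apply: (cvgr_neq0 (w y0 o0 - 1)); last by rewrite subr_eq0.
      by apply: cvgB => //; exact: cvg_cst.
    by apply: filterS => t + _ wt; rewrite wt subrr eqxx.
  have [g1|g1] := eqVneq (o0 *m g y0 *m o0^T) 1%:M.
    by have := pos0 o0; rewrite g1 det1 => /(_ erefl w1); rewrite ltNge H0.
  have [i [j gij]] : exists i j, (o0 *m g y0 *m o0^T) i j != (1%:M : 'M[R]_p) i j.
    apply: contrapT => H; move/eqP: g1; apply; apply/matrixP => i j.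
    by apply/eqP/negP => /negP ne; apply: H; exists i, j.
  have : \forall t \near F, ((vec_mx t.1 : 'M[R]_(p, n)) *m g t.2 *m (vec_mx t.1)^T) i j
     - (1%:M : 'M[R]_p) i j != 0.
    apply: (cvgr_neq0 ((o0 *m g y0 *m o0^T) i j - (1%:M : 'M[R]_p) i j)).
      by apply: cvgB; [exact: cgram|exact: cvg_cst].
    by rewrite subr_eq0.
  by apply: filterS => t + gt _; rewrite gt subrr eqxx.
near=> y => v dv wv.
have Vy : V y by near: y.
have [q [gq qw]] := orthonormalize (metric_on_sym gV Vy) (pg Vy) dv.
rewrite -(qw _ (derivation_form_alternating (C y) (aw Vy))).
have := (near near_P y _) (mxvec q); rewrite /P mxvecK; apply => //; last first.
  by rewrite qw //; exact: aw.
move=> k /=; rewrite in_itv /=; case/mxvec_indexP: k => i j.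
rewrite mxvecE -ler_norml.
have := posdef_coord_bound (metric_on_sym gV Vy) (pg Vy) (row i q) j.
have -> : (row i q *m g y *m (row i q)^T) 0 0 = 1.
  transitivity ((q *m g y *m q^T) i i); last by rewrite gq mxE eqxx.
  rewrite [LHS]mxE [RHS]mxE; apply: eq_bigr => l _; rewrite !mxE; congr (_ * _).
  by apply: eq_bigr => l' _; rewrite !mxE.
rewrite mul1r mxE => le.
have lec : (q i j) ^+ 2 <= c ^+ 2.
  apply: le_trans le _; apply: (@le_trans _ _ c); first by move: j; near: y.
  by rewrite ler_eXnr.
rewrite -[leLHS]ger0_norm // -(@ler_pXn2r _ 2) ?nnegrE //.
  by rewrite normr_id real_normK // num_real.
exact: le_trans c1.
Unshelve. all: by end_near. Qed.

End LocalStrictness.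

(** * Plurisubharmonic functions on a calibrated manifold *)

Section Manifold.
Variables (R : realType) (n p : nat) (X : topologicalType).
Variables (M : smooth_structure R n X) (g : riemannian_metric M).
Variable phi : calibration p g.
Implicit Types (f h : X -> R) (a b : chart_index M) (x : X).

Lemma chart_img_chart a x : chart_dom a x -> chart_img a (chart a x).
Proof. by move=> ax; exists x. Qed.

Lemma open_chart_img a : open (chart_img a).
Proof. exact: chart_img_open. Qed.

Lemma metric_posdef a y : chart_img a y -> posdef (metric g a y).
Proof. by move=> ay v v0; exact: metric_pos. Qed.

Lemma chart_metric_on a : metric_on (chart_img a) (metric g a).
Proof.
split; [exact: chart_img_open|exact: metric_smooth|exact: Defs.metric_sym|].
by move=> y ay; apply: posdef_unit; exact: metric_posdef.
Qed.

Lemma chart_inv_chart f a x : chart_dom a x ->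
  (f \o chart_inv a) (chart a x) = f x.
Proof. by move=> ax /=; rewrite chartK. Qed.

Lemma near_chart_inv a x (P : set X) : chart_dom a x ->
  (\forall z \near x, P z) -> \forall y \near chart a x, P (chart_inv a y).
Proof.
move=> ax nP; have cinv : chart_inv a @ chart a x --> x.
  rewrite -[X in _ --> X](chartK ax).
  exact: chart_inv_continuous (chart_img_chart ax).
exact: (cinv _ nP).
Qed.

Lemma near_chart a x (P : set 'rV[R]_n) : chart_dom a x ->
  (\forall y \near chart a x, P y) -> \forall z \near x, P (chart a z).
Proof. by move=> ax nP; exact: (chart_continuous ax nP). Qed.

Lemma near_chart_dom a x : chart_dom a x -> \forall z \near x, chart_dom a z.
Proof. by move=> ax; exact: open_nbhs_nbhs (conj (chart_dom_open a) ax). Qed.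

Lemma smooth_fun_continuous f : smooth_fun M f -> continuous f.
Proof.
move=> sf x; have [a ax] := chart_dom_cover M x.
have df := smooth_on_differentiable (sf a) (chart_img_chart ax).
have cf : {for x, continuous ((f \o chart_inv a) \o chart a)}.
  apply: continuous_comp; first exact: chart_continuous.
  exact: differentiable_continuous df.
rewrite /continuous_at -(chart_inv_chart f ax).
apply: cvg_trans cf; apply: near_eq_cvg.
by apply: filterS (near_chart_dom ax) => z az /=; rewrite chartK.
Qed.

Lemma smooth_fun_local f :
  (forall x, exists2 h, smooth_fun M h & \forall z \near x, f z = h z) ->
  smooth_fun M f.
Proof.
move=> loc a; apply: smooth_on_local => _ [x ax <-].
have [h sh fh] := loc x.
exists (chart_img a), (h \o chart_inv a); split=> //; first exact: chart_img_chart.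
exact: (near_chart_inv (P := fun z => f z = h z)).
Qed.

Lemma smooth_funD f h : smooth_fun M f -> smooth_fun M h ->
  smooth_fun M (fun x => f x + h x).
Proof.
move=> sf sh a; exact: (smooth_onD (open_chart_img (a := a)) (sf a) (sh a)).
Qed.

Lemma smooth_fun_comp (th : nat -> R -> R) f :
  (forall k (t : R), is_derive t 1 (th k) (th k.+1 t)) -> smooth_fun M f ->
  smooth_fun M (fun x => th 0%N (f x)).
Proof.
move=> dth sf a; exact: (smooth_on_comp (open_chart_img (a := a)) dth (sf a)).
Qed.

Let H f a x : 'M[R]_n := hess_mx (metric g a) (f \o chart_inv a) (chart a x).

Lemma phi_hessianE f a x v : smooth_fun M f -> chart_dom a x ->
  phi_hessian phi f a x v = derivation_form (Defs.form phi a (chart a x)) (H f a x) v.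
Proof.
move=> sf ax; apply: eq_bigr => i _; congr (Defs.form _ _ _ (set_row _ _ _)).
exact: (covd_gradE (chart_metric_on a) (sf a) _ (chart_img_chart ax)).
Qed.

Lemma phi_hessian_near f h a x v : chart_dom a x ->
  smooth_fun M f -> smooth_fun M h -> (\forall z \near x, f z = h z) ->
  phi_hessian phi f a x v = phi_hessian phi h a x v.
Proof.
move=> ax sf sh fh; rewrite (phi_hessianE v sf ax) (phi_hessianE v sh ax) /H.
rewrite (@hess_mx_near _ _ _ _ (h \o chart_inv a)) //.
exact: (near_chart_inv (P := fun z => f z = h z)).
Qed.

Lemma phi_hessianD f h a x v : chart_dom a x ->
  smooth_fun M f -> smooth_fun M h ->
  phi_hessian phi (fun x => f x + h x) a x v =
  phi_hessian phi f a x v + phi_hessian phi h a x v.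
Proof.
move=> ax sf sh; have ay := chart_img_chart ax.
rewrite (phi_hessianE v (smooth_funD sf sh) ax) (phi_hessianE v sf ax).
rewrite (phi_hessianE v sh ax) -derivation_formD; last exact: form_alternating.
congr (derivation_form _ _ _).
exact: (hess_mxD (chart_metric_on a) (sf a) (sh a) ay).
Qed.

(** Composition with a convex increasing function can only add a nonnegative
    term to theta'(f) times the Hessian. *)
Lemma phi_hessian_comp_ge (th : nat -> R -> R) f a x v :
  (forall k (t : R), is_derive t 1 (th k) (th k.+1 t)) -> smooth_fun M f ->
  chart_dom a x -> phi_plane phi a x v -> 0 <= th 2%N (f x) ->
  th 1%N (f x) * phi_hessian phi f a x v <=
  phi_hessian phi (fun x => th 0%N (f x)) a x v.
Proof.
move=> dth sf ax [dv wv] th2; have ay := chart_img_chart ax.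
have aw := form_alternating phi ay.
have gV := chart_metric_on a.
have sthf := smooth_fun_comp dth sf.
rewrite (phi_hessianE v sthf ax) (phi_hessianE v sf ax) /H.
rewrite -[(fun x => th 0%N (f x)) \o _]/(fun y => th 0%N ((f \o chart_inv a) y)).
rewrite (hess_mx_comp gV dth (sf a) ay) chart_inv_chart //.
rewrite derivation_formD // !derivation_formZ // lerDl mulr_ge0 //.
set y := chart a x; set Y := grad (metric g a) (f \o chart_inv a) y.
have -> : derivation_form (Defs.form phi a y)
    ((\row_i 'D_(e_ R i) (f \o chart_inv a) y)^T *m Y) v =
  \sum_i (Y *m metric g a y *m (row i v)^T) 0 0 * Defs.form phi a y (set_row v i Y).
  apply: eq_bigr => i _; rewrite -altZ //; congr (Defs.form phi a y (set_row v i _)).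
  rewrite mulmxA -[(_ *m _) 0 0]/(bil (metric g a y) Y (row i v)).
  rewrite (grad_pairing gV (sf a) _ ay) derive_dir; last first.
    exact: smooth_on_differentiable (sf a) ay.
  rewrite [row i v *m _]mx11_scalar mul_scalar_mx; congr (_ *: _).
  by rewrite mxE; apply: eq_bigr => j _; rewrite !mxE.
apply: phi_plane_trace_ge0 => //.
- exact: Defs.metric_sym.
- exact: metric_posdef.
- by move=> u du; exact: form_comass.
Qed.

Lemma overlap_open a b : open (chart a @` (chart_dom a `&` chart_dom b)).
Proof.
rewrite openE => _ [x [ax bx] <-]; rewrite /interior.
have nimg : \forall y \near chart a x, chart_img a y.
  exact: open_nbhs_nbhs (conj (open_chart_img (a := a)) (chart_img_chart ax)).
have nb := near_chart_inv ax (near_chart_dom bx).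
apply: filterS2 nimg nb => _ [z az <-]; rewrite chartK // => bz.
by exists z.
Qed.

(** The form pulls back, and the Hessian endomorphisms are conjugate, under
    the chart change. *)
Lemma phi_hessian_change f a b x v : smooth_fun M f ->
  chart_dom a x -> chart_dom b x ->
  phi_hessian phi f a x v = phi_hessian phi f b x (v *m change_mx a b x).
Proof.
move=> sf ax bx; rewrite (phi_hessianE _ sf ax) (phi_hessianE _ sf bx).
pose V := chart a @` (chart_dom a `&` chart_dom b).
have Va : V `<=` chart_img a by move=> _ [z [az _] <-]; exact: chart_img_chart.
have gV : metric_on V (metric g a).
  have ga := chart_metric_on a; split; first exact: overlap_open.
  - exact: smooth_on_sub Va (metric_on_smooth ga).
  - by move=> y /Va ay; exact: (metric_on_sym ga ay).
  - by move=> y /Va ay; exact: (metric_on_unit ga ay).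
have Vx : V (chart a x) by exists x.
have E : H f a x *m change_mx a b x = change_mx a b x *m H f b x.
  have := @hess_mx_tau R n V (chart_img b) (metric g a) (metric g b)
    (f \o chart_inv a) (f \o chart_inv b) (chart b \o chart_inv a) (chart a x)
    gV (chart_metric_on b) (smooth_on_sub Va (sf a)) (sf b)
    (@transition_smooth _ _ _ M a b).
  rewrite /= chartK //; apply => //.
  - by move=> _ [z [az bz] <-]; rewrite chartK //; exact: chart_img_chart.
  - by move=> _ [z [az bz] <-]; rewrite !chartK.
  - move=> _ [z [az bz] <-]; rewrite chartK //; exact: metric_change.
apply: eq_bigr => i _; rewrite (form_change phi ax bx).
congr (Defs.form phi b _ _); apply/row_matrixP => k; rewrite row_mul.
have [->|ki] := eqVneq k i; last by rewrite !row_set_row_neq // row_mul.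
by rewrite !row_set_row row_mul -!mulmxA E.
Qed.

Lemma phi_plane_change a b x v : chart_dom a x -> chart_dom b x ->
  phi_plane phi a x v -> phi_plane phi b x (v *m change_mx a b x).
Proof.
move=> ax bx [dv wv]; split; last by rewrite -(form_change phi ax bx).
by move: dv; rewrite /unit_simple /gram (metric_change g ax bx) trmx_mul !mulmxA.
Qed.

(** Independence of the chart: one chart decides strictness at a point. *)
Lemma strictly_psh_at_chart f a x : smooth_fun M f -> chart_dom a x ->
  (forall v, phi_plane phi a x v -> 0 < phi_hessian phi f a x v) ->
  strictly_psh_at phi f x.
Proof.
move=> sf ax pos b bx v bv; rewrite (phi_hessian_change _ sf bx ax).
by apply: pos; exact: phi_plane_change bv.
Qed.

Lemma strictly_psh_near f x : smooth_fun M f -> strictly_psh_at phi f x ->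
  \forall z \near x, strictly_psh_at phi f z.
Proof.
move=> sf st; have [a ax] := chart_dom_cover M x.
have ay := chart_img_chart ax.
have gV := chart_metric_on a.
have := positive_planes_near gV (@metric_posdef a) (form_alternating phi (a := a))
  (@form_smooth _ _ _ _ _ _ phi a) (hess_mx_smooth gV (sf a)) ay.
have pos0 : forall v, \det (v *m metric g a (chart a x) *m v^T) = 1 ->
    Defs.form phi a (chart a x) v = 1 ->
    0 < derivation_form (Defs.form phi a (chart a x)) (H f a x) v.
  by move=> v dv wv; rewrite -(phi_hessianE v sf ax); exact: st.
move=> /(_ pos0) /(near_chart ax) nP.
apply: filterS2 (near_chart_dom ax) nP => z az Pz.
apply: (strictly_psh_at_chart sf az) => v [dv wv].
by rewrite (phi_hessianE v sf az); exact: Pz.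
Qed.

Lemma W_set_closed f : smooth_fun M f -> closed (W_set phi f).
Proof.
move=> sf; rewrite -openC openE => x /contrapT st.
apply: filterS (strictly_psh_near sf st) => z sz; exact.
Qed.

Lemma core_closed : closed (core phi).
Proof. by apply: closed_bigI => f [sf _]; exact: W_set_closed. Qed.

Lemma psh_comp (th : nat -> R -> R) f :
  (forall k (t : R), is_derive t 1 (th k) (th k.+1 t)) ->
  (forall t, 0 <= th 1%N t) -> (forall t, 0 <= th 2%N t) ->
  psh phi f -> psh phi (fun x => th 0%N (f x)).
Proof.
move=> dth th1 th2 [sf pf]; split; first exact: smooth_fun_comp.
move=> x a ax v pv; apply: le_trans (phi_hessian_comp_ge dth sf ax pv (th2 _)).
by apply: mulr_ge0; [exact: th1|exact: pf pv].
Qed.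

Lemma strictly_psh_comp (th : nat -> R -> R) f x :
  (forall k (t : R), is_derive t 1 (th k) (th k.+1 t)) ->
  0 < th 1%N (f x) -> 0 <= th 2%N (f x) -> smooth_fun M f ->
  strictly_psh_at phi f x -> strictly_psh_at phi (fun x => th 0%N (f x)) x.
Proof.
move=> dth th1 th2 sf pf a ax v pv.
apply: lt_le_trans (phi_hessian_comp_ge dth sf ax pv th2).
by apply: mulr_gt0; [exact: th1|exact: pf pv].
Qed.

Lemma pshD f h : psh phi f -> psh phi h -> psh phi (fun x => f x + h x).
Proof.
move=> [sf pf] [sh ph]; split; first exact: smooth_funD.
move=> x a ax v pv; rewrite (phi_hessianD v ax sf sh).
by apply: addr_ge0; [exact: pf pv|exact: ph pv].
Qed.

Lemma strictly_pshDl f h x : psh phi f -> psh phi h ->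
  strictly_psh_at phi f x -> strictly_psh_at phi (fun x => f x + h x) x.
Proof.
move=> [sf pf] [sh ph] st a ax v pv.
rewrite (phi_hessianD v ax sf sh).
by apply: ltr_wpDr; [exact: ph pv|exact: st pv].
Qed.

Lemma strictly_pshDr f h x : psh phi f -> psh phi h ->
  strictly_psh_at phi h x -> strictly_psh_at phi (fun x => f x + h x) x.
Proof.
move=> [sf pf] [sh ph] st a ax v pv.
rewrite (phi_hessianD v ax sf sh).
by apply: ltr_wpDl; [exact: pf pv|exact: st pv].
Qed.

Lemma psh_local f :
  (forall x, exists2 h, psh phi h & \forall z \near x, f z = h z) -> psh phi f.
Proof.
move=> loc; have sf : smooth_fun M f.
  by apply: smooth_fun_local => x; have [h [sh _] fh] := loc x; exists h.
split=> // x a ax v pv; have [h [sh ph] fh] := loc x.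
by rewrite (phi_hessian_near v ax sf sh fh); exact: ph pv.
Qed.

Lemma strictly_psh_local f h x : smooth_fun M f -> smooth_fun M h ->
  (\forall z \near x, f z = h z) -> strictly_psh_at phi h x ->
  strictly_psh_at phi f x.
Proof.
move=> sf sh fh st a ax v pv.
by rewrite (phi_hessian_near v ax sf sh fh); exact: st pv.
Qed.

Lemma strictly_psh_psh f : smooth_fun M f ->
  (forall x, strictly_psh_at phi f x) -> psh phi f.
Proof. by move=> sf st; split=> // x a ax v pv; exact: ltW (st x a ax v pv). Qed.

End Manifold.


(** * Gluing strict positivity along a proper exhaustion *)

(** What the gluing argument needs to know about plurisubharmonic functions (P)
    and about the points where they are strict (S).  Working with abstract P and
    S separates this argument from the geometry. *)
Record convex_cone (R : realType) (X : topologicalType) (P : set (X -> R))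
    (S : (X -> R) -> set X) : Prop := {
  cone_continuous : forall f : X -> R, P f -> continuous f;
  cone_add : forall f h : X -> R, P f -> P h -> P (fun x => f x + h x);
  cone_strict_addl : forall (f h : X -> R) (x : X), P f -> P h -> S f x ->
    S (fun x => f x + h x) x;
  cone_strict_addr : forall (f h : X -> R) (x : X), P f -> P h -> S h x ->
    S (fun x => f x + h x) x;
  cone_comp : forall (th : nat -> R -> R) (f : X -> R),
    (forall k (t : R), is_derive t 1 (th k) (th k.+1 t)) ->
    (forall t, 0 <= th 1%N t) -> (forall t, 0 <= th 2%N t) ->
    P f -> P (fun x => th 0%N (f x));
  cone_strict_comp : forall (th : nat -> R -> R) (f : X -> R) (x : X),
    (forall k (t : R), is_derive t 1 (th k) (th k.+1 t)) ->
    0 < th 1%N (f x) -> 0 <= th 2%N (f x) ->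
    P f -> S f x -> S (fun x => th 0%N (f x)) x;
  cone_strict_open : forall (f : X -> R) (x : X), P f -> S f x ->
    \forall z \near x, S f z;
  cone_local : forall f : X -> R,
    (forall x : X, exists2 h : X -> R, P h & \forall z \near x, f z = h z) -> P f;
  cone_strict_local : forall (f h : X -> R) (x : X), P f -> P h ->
    (\forall z \near x, f z = h z) -> S h x -> S f x }.

Section Cone.
Variables (R : realType) (X : topologicalType).
Variables (P : set (X -> R)) (S : (X -> R) -> set X).
Hypothesis PS : convex_cone P S.
Implicit Types (f h : X -> R) (x : X).

(** The core, in the abstract setting. *)
Definition never_strict : set X := [set x | forall f, P f -> ~ S f x].

Lemma cone_affine (c d : R) f : 0 <= c -> P f -> P (fun x => c * f x + d).
Proof. by move=> c0; exact: (cone_comp PS (is_derive_affine c d)). Qed.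

Lemma cone_strict_affine (c d : R) f x : 0 < c -> P f -> S f x ->
  S (fun x => c * f x + d) x.
Proof. by move=> c0; exact: (cone_strict_comp PS (is_derive_affine c d)). Qed.

Lemma cone_hinge f : P f -> P (fun x => hinge 0 (f x)).
Proof.
apply: (cone_comp PS (@is_derive_hinge R)); [exact: hinge1_ge0|exact: hinge2_ge0].
Qed.

Lemma cone_strict_hinge f x : 0 < f x -> P f -> S f x ->
  S (fun x => hinge 0 (f x)) x.
Proof.
move=> f0; apply: (cone_strict_comp PS (@is_derive_hinge R)).
  exact: hinge1_gt0.
exact: hinge2_ge0.
Qed.

(** Shift f to take the value 1 at x before applying the hinge function, which
    has positive derivative there. *)
Lemma nonneg_strict_off_core x : ~ never_strict x ->
  exists f, [/\ P f, forall z, 0 <= f z & S f x].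
Proof.
move=> ncx; have [f [pf st]] : exists f, P f /\ S f x.
  apply: contrapT => nex; apply: ncx => f pf st.
  by apply: nex; exists f.
pose f1 z := 1 * f z + (1 - f x).
have pf1 : P f1 by apply: cone_affine.
exists (fun z => hinge 0 (f1 z)); split.
- exact: cone_hinge.
- by move=> z; exact: hinge0_ge0.
- apply: cone_strict_hinge => //; last exact: cone_strict_affine.
  by rewrite /f1 mul1r addrCA subrr addr0.
Qed.

(** A finite covering argument.  The functions of P, ordered by the size of
    their strictness set, are directed because sums are strict wherever one of
    the terms is; compactness is used for the filter of this order. *)
Lemma compact_strict (K : set X) h : P h -> compact K ->
  (forall x, K x -> ~ never_strict x) ->
  exists f, [/\ P f, forall x, 0 <= f x
    & forall x, K x -> S f x].
Proof.
move=> ph cK Kcore.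
pose D : set (X -> R) := [set f | P f /\ forall x, 0 <= f x].
pose B f0 : set (X -> R) := [set f | D f /\
  forall x, S f0 x -> S f x].
have FF : Filter (filter_from D B).
  apply: filter_from_filter.
    exists (fun x => hinge 0 (h x)); split; first exact: cone_hinge.
    by move=> x; exact: hinge0_ge0.
  move=> f f' [pf f0] [pf' f'0]; exists (fun x => f x + f' x).
    by split; [exact: (cone_add PS)|move=> x; rewrite addr_ge0].
  move=> u [Du uS]; split; split=> // x st; apply: uS.
    exact: (cone_strict_addl PS).
  exact: (cone_strict_addr PS).
have /compact_near_coveringP NC := cK.
have [f Df Bf] : filter_from D B
    [set f | K `<=` [set x | S f x]].
  apply: (NC _ _ (fun f x => S f x) FF) => x Kx.
  have [f [pf f0 st]] := nonneg_strict_off_core (Kcore x Kx).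
  exists ([set z | S f z], B f) => /=.
    by split; [exact: (cone_strict_open PS pf) st|exists f].
  by move=> [z u] /= [stz [_ uS]]; exact: uS.
exists f; split; [by case: Df|by case: Df|].
by apply: (Bf f); split.
Qed.

Lemma sublevel_closed f (c : R) : continuous f -> closed [set x | f x <= c].
Proof.
by move=> cf; apply: (closed_comp (f := f) (D := [set t | t <= c])).
Qed.

Lemma superlevel_closed f (c : R) : continuous f -> closed [set x | c <= f x].
Proof.
by move=> cf; apply: (closed_comp (f := f) (D := [set t | c <= t])).
Qed.

Lemma compact_bound f (K : set X) : continuous f -> compact K ->
  exists2 c : R, 0 < c & forall x, K x -> f x < c.
Proof.
move=> cf cK; have [->|K0] := eqVneq K set0; first by exists 1.
have [x _ xmax] := compact_EVT_max ((set0P _).1 K0) cK (continuous_subspaceT cf).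
exists (`|f x| + 1); first by rewrite ltr_wpDl.
move=> z Kz; apply: le_lt_trans (xmax z _) _; first exact/mem_set.
by apply: le_lt_trans (ler_norm _) _; rewrite ltrDl.
Qed.

Section Exhaustion.
Variable h : X -> R.
Hypotheses (ph : P h) (proper_h : proper_exhaustion h).
Let ch : continuous h := cone_continuous PS ph.

Lemma proper_exhaustionD f : continuous f -> (forall x, 0 <= f x) ->
  proper_exhaustion (fun x => h x + f x).
Proof.
move=> cf f0 c; refine (@subclosed_compact _ _ _ _ (@proper_h c) _).
  by apply: sublevel_closed => x; apply: continuousD; [exact: ch|exact: cf].
by move=> x /=; apply: le_trans; rewrite lerDl.
Qed.

Hypothesis core_neg : forall x, never_strict x -> h x < 0.

(** The bound 1/2 keeps a perturbation of h by f from crossing the gap between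
    consecutive shells. *)
Lemma strict_on_shell (k : nat) : exists f, [/\ P f, forall x, 0 <= f x,
   forall x, h x <= k.+1%:R -> f x <= 2^-1
 & forall x, 0 <= h x <= k.+1%:R -> S f x].
Proof.
pose K := [set x | 0 <= h x <= k.+1%:R].
have cK : compact K.
  refine (@subclosed_compact _ _ _ _ (@proper_h k.+1%:R) _); last by move=> x /andP[].
  rewrite (_ : K = [set x | 0 <= h x] `&` [set x | h x <= k.+1%:R]).
    by apply: closedI; [exact: superlevel_closed|exact: sublevel_closed].
  by apply/seteqP; split=> x /=; [case/andP|move=> [? ?]; apply/andP].
have Kcore x : K x -> ~ never_strict x.
  by move=> /andP[hx _] /core_neg; rewrite ltNge hx.
have [f [pf f0 st]] := compact_strict ph cK Kcore.
have [c c0 fc] := compact_bound (cone_continuous PS pf) (@proper_h k.+1%:R).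
have c20 : 0 < (2 * c)^-1 by rewrite invr_gt0 mulr_gt0.
exists (fun x => (2 * c)^-1 * f x + 0); split.
- by apply: cone_affine => //; exact: ltW.
- by move=> x; rewrite addr0 mulr_ge0 // ltW.
- move=> x hx; rewrite addr0 invfM -mulrA -[leRHS]mulr1 ler_wpM2l ?invr_ge0 //.
  by rewrite mulrC ler_pdivrMr // mul1r ltW // fc.
- by move=> x hx; apply: cone_strict_affine => //; exact: st.
Qed.

(** The argument h + f + 1/2 - k of the hinge function is nonpositive on
    {h <= k - 1}, because f <= 1/2 there, and positive on {h >= k}. *)
Lemma shell_function (k : nat) : exists u : X -> R, [/\ P u,
   forall x, 0 <= u x, forall x, h x <= k%:R - 1 -> u x = 0
 & forall x, k%:R <= h x <= k.+1%:R -> S u x].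
Proof.
have [f [pf f0 f_le st]] := strict_on_shell k.
pose v x := 1 * (h x + f x) + (2^-1 - k%:R).
have pv : P v by apply: cone_affine => //; exact: (cone_add PS).
exists (fun x => hinge 0 (v x)); split.
- exact: cone_hinge.
- by move=> x; exact: hinge0_ge0.
- move=> x hx; apply: hinge_npos; rewrite /v.
  have /f_le : h x <= k.+1%:R by rewrite -natr1; lra.
  lra.
- move=> x /andP[kh hk]; apply: cone_strict_hinge => //.
    by rewrite /v; have := f0 x; lra.
  apply: cone_strict_affine => //; first exact: (cone_add PS).
  apply: (cone_strict_addr PS) => //; apply: st; rewrite hk andbT.
  by apply: le_trans kh.
Qed.

(** The sum of all shell functions is locally finite: where h <= m the terms of
    index larger than m vanish. *)
Lemma strict_above_core : exists F, [/\ P F, forall x, 0 <= F x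
  & forall x, 0 <= h x -> S F x].
Proof.
have [u uP] := choice shell_function.
pose T m x : R := \sum_(k < m) u k x.
have pu k : P (u k) by case: (uP k).
have T_S m x : T m.+1 x = T m x + u m x by rewrite /T big_ord_recr.
have pT m : P (T m).
  elim: m => [|m IH].
    (* The zero function, as the affine function 0 * h + 0. *)
    have := cone_affine 0 (lexx 0) ph.
    by congr (P _); apply/funext => x; rewrite /T big_ord0 mul0r addr0.
  have -> : T m.+1 = (fun x => T m x + u m x) by apply/funext => x; rewrite T_S.
  exact: (cone_add PS).
have stT m k x : (k < m)%N -> S (u k) x ->
    S (T m) x.
  elim: m => // m IH; rewrite ltnS leq_eqVlt => km stk.
  have -> : T m.+1 = (fun x => T m x + u m x) by apply/funext => z; rewrite T_S.
  case/predU1P: km => [km|km]; first by apply: (cone_strict_addr PS) => //; rewrite -km.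
  by apply: (cone_strict_addl PS) => //; exact: IH.
have T_stable m x : h x <= m%:R -> forall j, T (m.+1 + j)%N x = T m.+1 x.
  move=> hm; elim=> [|j IH]; first by rewrite addn0.
  rewrite addnS T_S IH; have [_ _ u0 _] := uP (m.+1 + j)%N.
  rewrite u0 ?addr0 // addSn -natr1 addrK.
  by apply: le_trans hm _; rewrite ler_nat leq_addr.
have T_eq m m' x : h x <= m%:R -> h x <= m'%:R -> T m.+1 x = T m'.+1 x.
  move=> hm hm'; rewrite -(T_stable m x hm m') -(T_stable m' x hm' m).
  by rewrite !addSn addnC.
pose N x := Num.bound `|h x|.
have hN x : h x < (N x)%:R by apply: le_lt_trans (ler_norm _) (archi_boundP _).
(* Any truncation beyond the level of x gives the same value. *)
pose F x := T (N x).+1 x.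
have F_near x : \forall z \near x, F z = T (N x).+1 z.
  have hlt : \forall z \near x, h z < (N x)%:R.
    exact: (@cvgr_lt _ _ (nbhs x) _ h (h x) (ch (x := x)) _ (hN x)).
  by apply: filterS hlt => z hz; apply: T_eq; exact: ltW.
have pF : P F by apply: (cone_local PS) => x; exists (T (N x).+1).
exists F; split => //.
- by move=> x; rewrite /F /T sumr_ge0 // => k _; case: (uP k).
move=> x hx.
apply: (cone_strict_local PS (h := T (N x).+1)) => //.
have /andP[kh hk] := truncn_itv hx.
have [_ _ _ stk] := uP (Num.truncn (h x)).
apply: (stT _ (Num.truncn (h x))); last by apply: stk; rewrite kh ltW.
rewrite ltnS -(ler_nat R); apply: le_trans kh _; exact: ltW.
Qed.

End Exhaustion.

Lemma proper_strict_off_compact h : P h -> proper_exhaustion h ->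
  compact never_strict ->
  exists f, [/\ P f, proper_exhaustion f
    & exists K : set X, compact K /\ forall x, ~ K x -> S f x].
Proof.
move=> ph proper_h ccore.
have [c c0 hc] := compact_bound (cone_continuous PS ph) ccore.
pose h' x := 1 * h x + (- c).
have ph' : P h' by exact: cone_affine.
have proper_h' : proper_exhaustion h'.
  move=> d; have := @proper_h (d + c); congr (compact _).
  by apply/seteqP; split=> x /=; rewrite /h'; lra.
have neg x : never_strict x -> h' x < 0 by move=> /hc; rewrite /h'; lra.
have [F [pF F0 st]] := strict_above_core ph' proper_h' neg.
exists (fun x => h' x + F x); split.
- exact: (cone_add PS).
- exact: (proper_exhaustionD ph' proper_h' (cone_continuous PS pF) F0).
exists [set x | h' x <= 0]; split; first exact: proper_h'.
move=> x /= /negP; rewrite -ltNge => hx; apply: (cone_strict_addr PS) => //.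
by apply: st; exact: ltW.
Qed.

Lemma proper_strict h : P h -> proper_exhaustion h -> never_strict = set0 ->
  exists f, [/\ P f, proper_exhaustion f & forall x, S f x].
Proof.
move=> ph proper_h core0.
have neg x : never_strict x -> h x < 0 by rewrite core0.
have [F [pF F0 stF]] := strict_above_core ph proper_h neg.
have ncore x : h x <= 0 -> ~ never_strict x by move=> _; rewrite core0.
have [f [pf f0 stf]] := compact_strict ph (@proper_h 0) ncore.
have pFf : P (fun x => F x + f x) by exact: (cone_add PS).
exists (fun x => h x + (F x + f x)); split.
- exact: (cone_add PS).
- apply: (proper_exhaustionD ph proper_h (cone_continuous PS pFf)).
  by move=> x; rewrite addr_ge0.
move=> x; apply: (cone_strict_addr PS) => //.
have [h0|h0] := leP 0 (h x).
  by apply: (cone_strict_addl PS) => //; exact: stF.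
by apply: (cone_strict_addr PS) => //; apply: stf; exact: ltW.
Qed.

End Cone.

(** * The core of a calibrated manifold *)

Section CalibratedCone.
Variables (R : realType) (n p : nat) (X : topologicalType).
Variables (M : smooth_structure R n X) (g : riemannian_metric M).
Variable phi : calibration p g.

Lemma psh_convex_cone : convex_cone (psh phi) (strictly_psh_at phi).
Proof.
split.
- by move=> f [sf _]; exact: smooth_fun_continuous sf.
- exact: pshD.
- exact: strictly_pshDl.
- exact: strictly_pshDr.
- exact: psh_comp.
- by move=> th f x dth th1 th2 [sf _]; exact: strictly_psh_comp.
- by move=> f x [sf _]; exact: strictly_psh_near.
- exact: psh_local.
- by move=> f h x [sf _] [sh _]; exact: strictly_psh_local.
Qed.

Lemma compact_core_of_strictly_phi_convex_at_infty :
  strictly_phi_convex_at_infty phi -> compact (core phi).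
Proof.
move=> [f [pf _ [K [cK st]]]].
refine (@subclosed_compact _ _ _ (@core_closed _ _ _ _ _ _ phi) cK _).
by move=> x cx; apply: contrapT => /st; exact: cx.
Qed.

Lemma empty_core_of_strictly_phi_convex :
  strictly_phi_convex phi -> core phi = set0.
Proof.
move=> [f [sf _ st]]; apply/seteqP; split=> // x cx.
exact: (cx f (strictly_psh_psh sf st) (st x)).
Qed.

End CalibratedCone.

Theorem proposition3p14 (R : realType) (n p : nat) (X : topologicalType)
    (M : smooth_structure R n X) (g : riemannian_metric M)
    (phi : calibration p g)
    (X_noncompact : ~ compact [set: X])
    (X_connected : connected [set: X])
    (X_phi_convex : phi_convex phi) :
  (compact (core phi) <-> strictly_phi_convex_at_infty phi)
  /\ (core phi = set0 <-> strictly_phi_convex phi).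
Proof.
have [h [ph proper_h]] := X_phi_convex.
have PS := psh_convex_cone phi.
split; split.
- exact: (proper_strict_off_compact PS ph proper_h).
- exact: compact_core_of_strictly_phi_convex_at_infty.
- move=> core0; have [f [pf proper_f st]] := proper_strict PS ph proper_h core0.
  by exists f; split => //; case: pf.
- exact: empty_core_of_strictly_phi_convex.
Qed.
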